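(* Let $d\ge2$, let $Y$ be a closed parallelepiped of $\mathbb{R}^d$, and let $u\in C^2(\mathbb{R}^d)$ be such that $\nabla u$ is $Y$-periodic, $\langle\nabla u\rangle\neq0$, and $\nabla u\neq0$ everywhere in $\mathbb{R}^d$. For $x\in\mathbb{R}^d$ let $X(\cdot,x)$ denote the solution of $$\frac{dX}{dt}(t,x)=\nabla u\big(X(t,x)\big),\quad t\in\mathbb{R},\qquad X(0,x)=x .$$ Assume that there exists a hyperplane $H:=\{x\in\mathbb{R}^d: x\cdot\nu=h\}$ such that each trajectory $X(\cdot,x)$, for $x\in\mathbb{R}^d$, intersects $H$ only at one point $z_H(x)=X\big(\tau_H(x),x\big)$ and at a unique time $\tau_H(x)\in\mathbb{R}$, in such a way that $\nabla u$ is not tangential to $H$ at $z_H(x)$ (i.e. $\nabla u(z_H(x))\cdot\nu\ne 0$). Then the gradient $\nabla u$ is an isotropically realizable electric field in $\mathbb{R}^d$.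
   Context: $\langle\cdot\rangle$ denotes the average over $Y$. For $u\in C^1(\mathbb{R}^d)$, the field $\nabla u$ is an isotropically realizable electric field in $\mathbb{R}^d$ if there exists a positive scalar function $\sigma\in L^\infty_{\rm loc}(\mathbb{R}^d)$ (not required to be periodic) such that $\operatorname{div}(\sigma\nabla u)=0$ in the sense of distributions on $\mathbb{R}^d$. *)

(* Defs.v *)
From HB Require Import structures.
From mathcomp Require Import all_boot all_order all_algebra.
From mathcomp Require Import all_classical all_reals all_analysis.

Set Implicit Arguments.
Unset Strict Implicit.
Unset Printing Implicit Defensive.
Import Order.TTheory GRing.Theory Num.Theory.
Import numFieldNormedType.Exports.

Local Open Scope classical_set_scope.
Local Open Scope ring_scope.

Definition measure_rV_display : measure_display.
Proof. exact: default_measure_display. Qed.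

Section measurable_rV.
Context {R : realType} (n : nat).

Let coord : 'I_n -> 'rV[R]_n -> measurableTypeR R := fun i x => x ord0 i.

Let rV_set0 : g_sigma_preimage coord set0.
Proof. exact: sigma_algebra0. Qed.

Let rV_setC A : g_sigma_preimage coord A -> g_sigma_preimage coord (~` A).
Proof. exact: sigma_algebraC. Qed.

Let rV_bigcup (F : _^nat) : (forall i, g_sigma_preimage coord (F i)) ->
  g_sigma_preimage coord (\bigcup_i (F i)).
Proof. exact: sigma_algebra_bigcup. Qed.

(* The sigma-algebra generated by the coordinates, i.e., the Borel sets
   of R^n. *)
HB.instance Definition _ := @isMeasurable.Build
  measure_rV_display 'rV[R]_n
  (g_sigma_preimage coord) rV_set0 rV_setC rV_bigcup.

Lemma measurable_coord (i : 'I_n) :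
  measurable_fun [set: 'rV[R]_n] (fun x : 'rV[R]_n => x ord0 i : measurableTypeR R).
Proof.
move=> _ Y mY; rewrite setTI; apply: sub_sigma_algebra => /=.
rewrite -bigcup_seq/=; exists i => /=; first by rewrite mem_index_enum.
by exists Y => //; rewrite setTI.
Qed.

Lemma measurable_fun_rVP d (T : measurableType d) (f : T -> 'rV[R]_n) :
  (forall i, measurable_fun [set: T] (fun x => f x ord0 i : measurableTypeR R)) ->
  measurable_fun [set: T] f.
Proof.
move=> mf.
suff : g_sigma_preimage (fun i => coord i \o f) `<=` measurable.
  rewrite g_sigma_preimage_comp => prefS _ A mA.
  by apply: prefS; exists A.
apply: smallest_sub; first exact: sigma_algebra_measurable.
rewrite -bigcup_seq; apply: bigcup_sub => i _.
by move=> A [B mB <-]; exact: mf.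
Qed.

End measurable_rV.

Section cons_rV.
Context {R : realType} (n : nat).

Definition cons_rV (p : measurableTypeR R * 'rV[R]_n) : 'rV[R]_n.+1 :=
  \row_i if unlift ord0 i is Some j then p.2 ord0 j else p.1.

Definition uncons_rV (x : 'rV[R]_n.+1) : measurableTypeR R * 'rV[R]_n :=
  (x ord0 ord0, \row_j x ord0 (lift ord0 j)).

Lemma cons_rVK : cancel cons_rV uncons_rV.
Proof.
move=> [a v]; congr pair; first by rewrite mxE unlift_none.
by apply/rowP => j; rewrite !mxE liftK.
Qed.

Lemma measurable_cons_rV : measurable_fun setT cons_rV.
Proof.
apply: measurable_fun_rVP => i.
case: (unliftP ord0 i) => [j|] ->.
  rewrite (_ : (fun p => _) = (fun x : 'rV[R]_n => x ord0 j : measurableTypeR R) \o snd).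
    exact: (measurableT_comp (measurable_coord j) measurable_snd).
  by apply/funext => p; rewrite mxE liftK.
rewrite (_ : (fun p => _) = fst); first exact: measurable_fst.
by apply/funext => p; rewrite mxE unlift_none.
Qed.

Lemma measurable_uncons_rV : measurable_fun setT uncons_rV.
Proof.
apply/measurable_fun_pairP; split; first exact: measurable_coord.
apply: measurable_fun_rVP => j.
rewrite (_ : (fun x => _) =
    (fun x : 'rV[R]_n.+1 => x ord0 (lift ord0 j) : measurableTypeR R)).
  exact: measurable_coord.
by apply/funext => x; rewrite /= mxE.
Qed.

Variable mu : {sigma_finite_measure set 'rV[R]_n -> \bar R}.

Definition lebesgue_cons : set 'rV[R]_n.+1 -> \bar R :=
  pushforward (lebesgue_measure \x mu)%E cons_rV.

Let measurable_cons_preimage A :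
  measurable A -> measurable (cons_rV @^-1` A).
Proof. by move=> mA; rewrite -[X in measurable X]setTI; exact: measurable_cons_rV. Qed.

Let lebesgue_cons0 : lebesgue_cons set0 = 0%E.
Proof. by rewrite /lebesgue_cons /pushforward preimage_set0 measure0. Qed.

Let lebesgue_cons_ge0 A : (0 <= lebesgue_cons A)%E.
Proof. exact: (measure_ge0 (lebesgue_measure \x mu)%E). Qed.

Let lebesgue_cons_sigma_additive : semi_sigma_additive lebesgue_cons.
Proof.
move=> F mF tF mUF; rewrite /lebesgue_cons /pushforward preimage_bigcup.
apply: measure_semi_sigma_additive.
- by move=> k; exact: measurable_cons_preimage.
- apply/trivIsetP => /= i j _ _ ij; rewrite -preimage_setI.
  by move/trivIsetP : tF => /(_ _ _ _ _ ij) ->//; rewrite preimage_set0.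
- by rewrite -preimage_bigcup; exact: measurable_cons_preimage.
Qed.

HB.instance Definition _ := isMeasure.Build _ _ _ lebesgue_cons
  lebesgue_cons0 lebesgue_cons_ge0 lebesgue_cons_sigma_additive.

Let lebesgue_cons_sigma_finite : sigma_finite setT lebesgue_cons.
Proof.
have /sigma_finiteP[F [TF ndF Foo]] := sigma_finiteT (@lebesgue_measure R).
have /sigma_finiteP[G [TG ndG Goo]] := sigma_finiteT mu.
exists (fun k => uncons_rV @^-1` (F k `*` G k)).
  apply/esym/seteqP; split => // x _.
  have [i _ Fi] : (\bigcup_k F k) (uncons_rV x).1 by rewrite -TF.
  have [j _ Gj] : (\bigcup_k G k) (uncons_rV x).2 by rewrite -TG.
  exists (maxn i j) => //; split.
  - by move: Fi; exact/subsetPset/ndF/leq_maxl.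
  - by move: Gj; exact/subsetPset/ndG/leq_maxr.
move=> k; have [mF Fk] := Foo k; have [mG Gk] := Goo k; split.
  rewrite -[X in measurable X]setTI.
  by apply: measurable_uncons_rV => //; exact: measurableX.
rewrite /lebesgue_cons /pushforward -comp_preimage.
rewrite (_ : _ \o _ = id) ?preimage_id; last first.
  by apply/funext => p; rewrite /= cons_rVK.
by rewrite product_measure1E// lte_mul_pinfty// ge0_fin_numE.
Qed.

HB.instance Definition _ := Measure_isSigmaFinite.Build _ _ _ lebesgue_cons
  lebesgue_cons_sigma_finite.

End cons_rV.

Section lebesgue_rV.
Context {R : realType}.

Fixpoint lebesgue_rV (n : nat) : {sigma_finite_measure set 'rV[R]_n -> \bar R} :=
  match n with
  | 0 => \d_(0 : 'rV[R]_0)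
  | k.+1 => lebesgue_cons (lebesgue_rV k)
  end.

Lemma lebesgue_rV_box (n : nat) (A : 'I_n -> set (measurableTypeR R)) :
  (forall i, measurable (A i)) ->
  lebesgue_rV n [set x | forall i, A i (x ord0 i)] =
  (\prod_(i < n) lebesgue_measure (A i))%E.
Proof.
elim: n A => [|n IHn] A mA.
  by rewrite big_ord0 /= diracE mem_set// => -[].
rewrite big_ord_recl /= /lebesgue_cons /pushforward -IHn//.
rewrite (_ : _ @^-1` _ =
  A ord0 `*` [set x : 'rV[R]_n | forall i, A (lift ord0 i) (x ord0 i)]).
  rewrite product_measure1E//.
  rewrite (_ : [set _ | _] = \big[setI/setT]_(i < n)
    ((fun x : 'rV[R]_n => x ord0 i) @^-1` A (lift ord0 i))).
    apply: bigsetI_measurable => i _.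
    by rewrite -[X in measurable X]setTI; exact: measurable_coord.
  by rewrite -bigcap_seq; apply/seteqP; split => x /=;
     [move=> Ax i _; exact: Ax | move=> Ax i; apply: Ax => /=; rewrite mem_index_enum].
apply/seteqP; split => [[a v] /= Ax|[a v] /= [Aa Av] i].
  split; first by have := Ax ord0; rewrite mxE unlift_none.
  by move=> i; have := Ax (lift ord0 i); rewrite mxE liftK.
by rewrite mxE; case: unliftP => [j|] ->.
Qed.

End lebesgue_rV.

Section calculus.
Context {R : realType} {d : nat}.
Implicit Types (f u : 'rV[R]_d -> R) (F : 'rV[R]_d -> 'rV[R]_d).

Definition dotp (x y : 'rV[R]_d) : R := \sum_(i < d) x ord0 i * y ord0 i.

Definition partial (i : 'I_d) f : 'rV[R]_d -> R := 'D_(delta_mx ord0 i) f.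

Definition grad f (x : 'rV[R]_d) : 'rV[R]_d := \row_i partial i f x.

Fixpoint Cn (n : nat) f : Prop :=
  match n with
  | 0 => continuous f
  | k.+1 => (forall x, differentiable f x) /\ forall i, Cn k (partial i f)
  end.

Definition test_function (phi : 'rV[R]_d -> R) : Prop :=
  (forall n, Cn n phi) /\ compact (closure [set x | phi x != 0]).

(* The distribution div F, for F locally integrable, applied to phi. *)
Definition distr_div F (phi : 'rV[R]_d -> R) : R :=
  - \int[lebesgue_rV d]_x dotp (F x) (grad phi x).

Definition Linfty_loc f : Prop :=
  measurable_fun [set: 'rV[R]_d] f /\
  forall K : set 'rV[R]_d, compact K ->
    (Lnorm (lebesgue_rV d) +oo (EFin \o (f \_ K)) < +oo)%E.

(* For u of class C^1: the electric field grad u is realized by the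
   conductivity sigma. *)
Definition isotropically_realizable u : Prop :=
  exists sigma : 'rV[R]_d -> R,
    [/\ Linfty_loc sigma, forall x, 0 < sigma x &
        forall phi, test_function phi ->
          distr_div (fun x => sigma x *: grad u x) phi = 0].

(* The closed parallelepiped with vertex a spanned by the rows of E;
   it is non-degenerate when E \in unitmx. *)
Definition parallelepiped (a : 'rV[R]_d) (E : 'M[R]_d) : set 'rV[R]_d :=
  [set x | exists2 t : 'rV[R]_d,
     forall i, 0 <= t ord0 i <= 1 & x = a + t *m E].

(* Periodicity with respect to the lattice generated by the edges of a
   parallelepiped. *)
Definition edge_periodic (E : 'M[R]_d) F : Prop :=
  forall (x : 'rV[R]_d) (i : 'I_d), F (x + row i E) = F x.

Definition average (Y : set 'rV[R]_d) F : 'rV[R]_d :=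
  \row_i ((fine (lebesgue_rV d Y))^-1 *
          \int[lebesgue_rV d]_(x in Y) F x ord0 i).

Definition hyperplane (nu : 'rV[R]_d) (h : R) : set 'rV[R]_d :=
  [set x | dotp x nu = h].

(* X t x is the position at time t of the trajectory starting at x. *)
Definition is_flow F (X : R -> 'rV[R]_d -> 'rV[R]_d) : Prop :=
  forall x, X 0 x = x /\
    forall t, is_derive t (1 : R) (fun s : R => X s x) (F (X t x)).

End calculus.

(* Main.v *)
Require Import Defs.
From mathcomp Require Import all_boot all_order all_algebra.
From mathcomp Require Import all_classical all_reals all_analysis.
From mathcomp Require Import measurable_realfun ess_sup_inf.
From mathcomp Require Import ring lra.
Import Order.TTheory GRing.Theory Num.Theory.
Import numFieldNormedType.Exports.

Set Implicit Arguments.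
Unset Strict Implicit.
Unset Printing Implicit Defensive.

Local Open Scope classical_set_scope.
Local Open Scope ring_scope.

(* Along the trajectories of [b = grad u] put [P x t = \int_0^t (div b) (X s x) ds]
   and [sigma x = expR (P x (tau_H x))]. Since [tau_H (X t x) = tau_H x - t], we
   have [sigma (X t x) * expR (P x t) = sigma x]; by Liouville's formula the
   measure [sigma dx] is thus invariant under the flow. Differentiating
   [\int sigma(x) phi(X t x) dx = \int sigma phi] at [t = 0] yields
   [\int sigma b . grad phi = 0]; no derivative of [sigma] is involved.

   Liouville's formula is obtained without differentiating the flow with respect
   to its initial point. The shear [x |-> x + h b_i(x) e_i] satisfies an exact
   change of variables with weight [1 + h d_i b_i(x)], by the fundamental theorem
   of calculus on each line parallel to [e_i]. Composing the shears of all
   coordinates [N] times with [h = t / N], the maps converge to [X t] and the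
   weights to [expR (P x t)]. The same scheme shows that the flow is Lipschitz,
   and the crossing time is continuous because [X t x . nu - h] changes sign
   strictly at [t = tau_H x]. *)

(** * Row vectors: sup norm, compactness and Borel sets *)

Section row_vectors.
Context {R : realType} {n : nat}.
Implicit Types (x y : 'rV[R]_n) (f : 'rV[R]_n -> R).

Lemma coord_le_norm x i : `|x ord0 i| <= `|x|.
Proof.
rewrite [leRHS]/Num.Def.normr /= mx_normrE; apply/bigmax_geP; right => /=.
by exists (ord0, i).
Qed.

Lemma norm_rV_le x (r : R) :
  0 <= r -> (forall i, `|x ord0 i| <= r) -> `|x| <= r.
Proof.
move=> r0 xr; rewrite [leLHS]/Num.Def.normr /= mx_normrE; apply/bigmax_leP; split => //.
by move=> [i j] _ /=; rewrite ord1.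
Qed.

Lemma norm_delta_rV (i : 'I_n) : `|delta_mx ord0 i : 'rV[R]_n| <= 1.
Proof.
apply: norm_rV_le => // j; rewrite mxE eqxx /=.
by case: (j == i); rewrite ?normr1 ?normr0.
Qed.

Lemma compact_norm_le (B : R) : compact [set x : 'rV[R]_n | `|x| <= B].
Proof.
apply: bounded_closed_compact.
- exists B; split; first exact: num_real.
  by move=> M BM x /= xB; rewrite (le_trans xB)// ltW.
- rewrite (_ : [set _ | _] = Num.Def.normr @^-1` [set r | r <= B])//.
  by apply: closed_comp; [move=> x _; exact: norm_continuous|exact: closed_le].
Qed.

(** Only [x] is confined to [K], so a point of a trajectory can be compared with any nearby point,
    whether or not that point lies in [K]. The near-covering form of compactness turns the local
    radii into a common one. *)
Lemma compact_unif_continuous (T : pseudoMetricNormedZmodType R) (K : set 'rV[R]_n)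
    (f : 'rV[R]_n -> T) : compact K -> continuous f ->
  forall e : R, 0 < e -> exists2 r : R, 0 < r &
    forall x y, K x -> `|x - y| < r -> `|f x - f y| < e.
Proof.
move=> cK cf e e0.
have /compact_near_coveringP cov := cK.
have : \forall r \near (0 : R)^'+, K `<=`
    [set x | forall y, `|x - y| < r -> `|f x - f y| < e].
  apply: (cov _ (0 : R)^'+ (fun r x => forall y, `|x - y| < r -> `|f x - f y| < e)).
  move=> x Kx.
  have e20 : 0 < e / 2 by rewrite divr_gt0.
  have /cvgrPdist_lt /(_ _ e20) := cf x.
  move=> /nbhs_ballP [r /= r0 xr].
  have r20 : 0 < r / 2 by rewrite divr_gt0.
  exists (ball x (r / 2), [set s | s < r / 2]) => /=.
    by split; [exact: nbhsx_ballx|exact: nbhs_right_lt].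
  move=> [x' s] /= [xx' sr] y x'y.
  have xx'e : `|f x - f x'| < e / 2.
    by by apply: xr; apply: le_ball xx'; lra.
  have xye : `|f x - f y| < e / 2.
    apply: xr; rewrite -ball_normE /= (splitr r).
    rewrite (le_lt_trans (ler_distD x' _ _))// ltrD// ?(lt_trans x'y)//.
    by rewrite -ball_normE /= in xx'.
  rewrite (splitr e) (le_lt_trans (ler_distD (f x) _ _))// ltrD//.
  by rewrite distrC.
move=> H.
near (0 : R)^'+ => r.
exists r => //.
move=> x y Kx xy.
have /(_ x Kx) : K `<=` [set x | forall y, `|x - y| < r -> `|f x - f y| < e].
  by near: r.
exact.
Unshelve. all: by end_near. Qed.

Lemma compact_norm_bounded (K : set 'rV[R]_n) f : compact K -> continuous f ->
  exists2 M : R, 0 < M & forall x, K x -> `|f x| <= M.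
Proof.
move=> cK cf.
have /compact_bounded[M [Mr HM]] : compact (f @` K).
  by by apply: continuous_compact => //; apply: continuous_subspaceT.
exists (`|M| + 1); first by rewrite ltr_wpDl.
by move=> x Kx; apply: HM; [rewrite (le_lt_trans (ler_norm M))// ltrDl|exists x].
Qed.

Lemma ball_rVE x (r : R) : 0 < r -> ball x r =
  [set y | forall i, `]x ord0 i - r, x ord0 i + r[%classic (y ord0 i)].
Proof.
move=> r0; apply/seteqP; split => y /=.
- move=> [_ H] i; have := H ord0 i.
  by rewrite -ball_normE /= in_itv /= -ltr_distlC.
- move=> H; split => // i j; have := H j; rewrite (ord1 i).
  by rewrite -ball_normE /= in_itv /= -ltr_distlC.
Qed.

Lemma measurable_box_rV (A : 'I_n -> set (measurableTypeR R)) :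
  (forall i, measurable (A i)) ->
  measurable [set x : 'rV[R]_n | forall i, A i (x ord0 i)].
Proof.
move=> mA; rewrite (_ : [set _ | _] = \big[setI/setT]_(i < n)
    ((fun x : 'rV[R]_n => x ord0 i) @^-1` A i)).
  apply: bigsetI_measurable => i _.
  by rewrite -[X in measurable X]setTI; exact: measurable_coord.
rewrite -bigcap_seq; apply/seteqP; split => x /=.
- by move=> Ax i _; exact: Ax.
- by move=> Ax i; apply: Ax => /=; rewrite mem_index_enum.
Qed.

(** The sigma-algebra is generated by the coordinates. In the sup norm balls are boxes, hence
    measurable, and an open set is a countable union of balls with rational centres. *)
Lemma open_measurable_rV (U : set 'rV[R]_n) : open U -> measurable U.
Proof.
move=> oU.
pose q (p : 'rV[rat]_n * nat) := map_mx (@ratr R) p.1.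
pose r (p : 'rV[rat]_n * nat) : R := p.2.+1%:R^-1.
have -> : U = \bigcup_(p in [set p | ball (q p) (r p) `<=` U]) ball (q p) (r p).
  apply/seteqP; split => [x Ux|x [p pU]]; last exact: pU.
  have /nbhs_ballP[e /= e0 xeU] : nbhs x U by exact: open_nbhs_nbhs.
  have e20 : 0 < e / 2 by rewrite divr_gt0.
  (* With [1 / (k + 1) < e / 2], a ball of radius [1 / (k + 1)] whose rational centre lies within
     that distance of [x] contains [x] and stays in the ball of radius [e]. *)
  pose k := Num.truncn (e / 2)^-1.
  have k0 : 0 < k.+1%:R^-1 :> R by [].
  have ke : k.+1%:R^-1 < e / 2.
    by rewrite invf_plt ?posrE// truncnS_gt.
  have H (i : 'I_n) : exists s : rat, ratr s \in `]x ord0 i, x ord0 i + k.+1%:R^-1[.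
    by apply: rat_in_itvoo; rewrite ltrDl.
  pose s := \row_i (projT1 (cid (H i))).
  have qx i : x ord0 i < (q (s, k)) ord0 i < x ord0 i + k.+1%:R^-1.
    by rewrite !mxE; case: (cid (H i)) => z /=; rewrite in_itv.
  exists (s, k) => /=.
  - apply: subset_trans xeU => y; rewrite /r /= !ball_rVE// => H1 i.
    have := H1 i; have := qx i; rewrite /= !in_itv /=.
    move: ke; set a := (q (s, k)) ord0 i; set d := k.+1%:R^-1; lra.
  - rewrite /r /= ball_rVE// => i /=; have := qx i; rewrite /= in_itv /=.
    set a := (q (s, k)) ord0 i; set d := k.+1%:R^-1; lra.
(* Padding with empty sets lets the union run over the whole countable index type. *)
rewrite [X in measurable X](_ : _ = \bigcup_p
  (if `[< ball (q p) (r p) `<=` U >] then ball (q p) (r p) else set0)).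
  apply: countable_bigcupT_measurable.
    by apply: countableP.
  move=> p; case: ifPn => // _; rewrite ball_rVE; last by rewrite /r.
  by apply: (@measurable_box_rV (fun i => `]_, _[%classic)) => i; exact: measurable_itv.
apply/seteqP; split => x.
- by move=> [p /= pU px]; exists p => //; rewrite asboolT.
- move=> [p _]; case: ifPn => // /asboolP pU px.
  by exists p.
Qed.

Lemma continuous_measurable_rV f : continuous f ->
  measurable_fun [set: 'rV[R]_n] (f : 'rV[R]_n -> measurableTypeR R).
Proof.
move=> cf; apply: (measurability _ (RGenOpens.measurableE R)).
move=> _ [_ [a [b ->] <-]]; rewrite setTI.
by apply: open_measurable_rV; apply: open_comp => //; exact: interval_open.
Qed.

End row_vectors.

Lemma lipschitz_continuous_rV {R : realType} n (W : normedModType R)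
    (f : 'rV[R]_n -> W) (L : R) :
  (forall x y, `|f x - f y| <= L * `|x - y|) -> continuous f.
Proof.
move=> fL x; suff : forall e : R, 0 < e -> \forall y \near x, `|f x - f y| < e.
  by move=> /cvgrPdist_lt.
move=> e e0; apply/nbhs_ballP.
have L0 : 0 < `|L| + 1 by rewrite ltr_wpDl.
exists (e / (`|L| + 1)); first by rewrite /= divr_gt0.
move=> y; rewrite -ball_normE /= ltr_pdivlMr// mulrC => xy.
rewrite (le_lt_trans (fL x y))// (le_lt_trans _ xy)// ler_wpM2r//.
by rewrite (le_trans (ler_norm L))// lerDl.
Qed.

(** * Integration over lines *)

Lemma bounded_support_integrable d (T : measurableType d) (R : realType)
    (mu : {measure set T -> \bar R}) (A : set T) (f : T -> R) (M : R) :
  measurable A -> (mu A < +oo)%E -> measurable_fun [set: T] f ->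
  (forall x, `|f x| <= M) -> (forall x, ~ A x -> f x = 0) ->
  mu.-integrable [set: T] (EFin \o f).
Proof.
move=> mA Aoo mf fM f0.
have <- : (EFin \o f) \_ A = EFin \o f.
  apply/funext => x; rewrite patchE; case: ifPn => // /negP xA.
  by rewrite /= f0// => Ax; apply: xA; rewrite inE.
apply/(integrable_mkcond (EFin \o f) mA); apply: measurable_bounded_integrable => //.
- exact: measurable_funTS.
- exists M; split; first exact: num_real.
  by move=> N MN x _ /=; rewrite (le_trans (fM x))// ltW.
Qed.

Section bounded_support.
Context {R : realType}.

Definition bounded_support n (g : 'rV[R]_n -> R) :=
  exists B : R, forall x, B < `|x| -> g x = 0.

Definition box n (B : R) : set 'rV[R]_n :=
  [set x | forall i, `[- B, B]%classic (x ord0 i)].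

Lemma norm_le_box n (B : R) (x : 'rV[R]_n) : `|x| <= B -> box B x.
Proof.
by move=> xB i; rewrite /= in_itv /= -ler_norml (le_trans (coord_le_norm _ _)).
Qed.

Lemma measurable_box n (B : R) :
  measurable (@box n B).
Proof. by apply: (@measurable_box_rV _ _ (fun=> `[_, _]%classic)). Qed.

Lemma lebesgue_rV_box_lty n (B : R) :
  (lebesgue_rV n (@box n B) < +oo)%E.
Proof.
rewrite (@lebesgue_rV_box R n (fun=> `[- B, B]%classic))//.
rewrite lebesgue_measure_itv /=.
suff : (\prod_(i < n) (if (- B)%:E < B%:E then B%:E - (- B)%:E else 0))%E
    \is a fin_num by rewrite fin_numElt => /andP[].
elim/big_ind : _ => // [x y|i _]; first exact: fin_numM.
by case: ifPn.
Qed.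

Lemma continuous_bounded n (g : 'rV[R]_n -> R) :
  continuous g -> bounded_support g -> exists2 M, 0 < M & forall x, `|g x| <= M.
Proof.
move=> cg [B gB].
have [M M0 gM] := compact_norm_bounded (@compact_norm_le R n B) cg.
exists M => // x; have [xB|/gB->] := leP `|x| B; first exact: gM.
by rewrite normr0 ltW.
Qed.

Lemma integrable_bounded_support n (g : 'rV[R]_n -> R) :
  continuous g -> bounded_support g ->
  (lebesgue_rV n).-integrable [set: 'rV[R]_n] (EFin \o g).
Proof.
move=> cg sg; have [M _ gM] := continuous_bounded cg sg.
have [B gB] := sg.
apply: (bounded_support_integrable (A := @box n B) (M := M)) => //.
- exact: measurable_box.
- exact: lebesgue_rV_box_lty.
- exact: continuous_measurable_rV.
- by move=> x xB; apply: gB; rewrite ltNge; apply/negP => /norm_le_box.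
Qed.

Lemma cons_rVE n (s : R) (v : 'rV[R]_n) i :
  cons_rV (s, v) ord0 i = if unlift ord0 i is Some j then v ord0 j else s.
Proof. by rewrite mxE. Qed.

Lemma cons_rV0D n (s t : R) (v : 'rV[R]_n) :
  cons_rV (t + s, v) = cons_rV (t, v) + s *: delta_mx ord0 ord0.
Proof.
apply/rowP => i; rewrite !mxE eqxx /=; case: unliftP => [j|] -> /=.
  by rewrite mulr0 addr0.
by rewrite mulr1.
Qed.

Lemma cons_rV_liftD n (s t : R) (v : 'rV[R]_n) (j : 'I_n) :
  cons_rV (t, v + s *: delta_mx ord0 j) =
  cons_rV (t, v) + s *: delta_mx ord0 (lift ord0 j).
Proof.
apply/rowP => i; rewrite !mxE eqxx /=; case: unliftP => [k|] -> /=.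
  by rewrite !mxE eqxx /= (inj_eq lift_inj).
by rewrite mulr0 addr0.
Qed.

Lemma norm_cons_rV_ge n (s : R) (v : 'rV[R]_n) : `|v| <= `|cons_rV (s, v)|.
Proof.
apply: norm_rV_le => // j; have := coord_le_norm (cons_rV (s, v)) (lift ord0 j).
by rewrite cons_rVE liftK.
Qed.

Lemma continuous_cons_rV n (s : R) :
  continuous (fun v : 'rV[R]_n => cons_rV (s, v)).
Proof.
apply: (@lipschitz_continuous_rV _ _ _ _ 1) => v w; rewrite mul1r.
apply: norm_rV_le => // i.
rewrite !mxE; case: unliftP => [j|] _ /=; last by rewrite subrr normr0.
by have := coord_le_norm (v - w) j; rewrite !mxE.
Qed.

(** [lebesgue_rV n.+1] is by construction the image of a product measure under [cons_rV]. The
    equality unfolds this, and the integrability is what Fubini's theorem asks for. *)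
Lemma integral_lebesgue_cons n (g : 'rV[R]_n.+1 -> R) :
  continuous g -> bounded_support g ->
  (\int[lebesgue_rV n.+1]_x (g x)%:E =
   \int[lebesgue_measure \x lebesgue_rV n]_p (g (cons_rV p))%:E)%E /\
  (lebesgue_measure \x lebesgue_rV n)%E.-integrable setT
    (fun p => (g (cons_rV p))%:E).
Proof.
move=> cg sg; have [M _ gM] := continuous_bounded cg sg.
have [B gB] := sg.
have mg := continuous_measurable_rV cg.
have ig : (lebesgue_measure \x lebesgue_rV n)%E.-integrable setT
    (EFin \o (fun p => g (cons_rV p))).
  apply: (bounded_support_integrable (A := @cons_rV R n @^-1` @box n.+1 B)
    (M := M)).
  - rewrite -[X in measurable X]setTI; apply: measurable_cons_rV => //.
    exact: measurable_box.
  - exact: (lebesgue_rV_box_lty n.+1 B).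
  - exact: (measurableT_comp mg (@measurable_cons_rV R n)).
  - by move=> p; exact: gM.
  - by move=> x xB; apply: gB; rewrite ltNge; apply/negP => /norm_le_box.
split => //=.
rewrite (@integral_pushforward _ _ _ _ _ _ (@measurable_cons_rV R n) _ setT
  (EFin \o g))//.
exact/measurable_EFinP.
Qed.

Lemma bounded_support_cons n (g : 'rV[R]_n.+1 -> R) s :
  bounded_support g -> bounded_support (fun v => g (cons_rV (s, v))).
Proof.
by move=> [B gB]; exists B => v vB; apply/gB/(lt_le_trans vB)/norm_cons_rV_ge.
Qed.

(** Fubini, by induction on the dimension. If [i] is not the first coordinate, the lines lie in the
    slices where the first coordinate is fixed, and the induction hypothesis applies to each
    slice. *)
Lemma eq_integral_lines n (g1 g2 : 'rV[R]_n -> R) (i : 'I_n) :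
  continuous g1 -> bounded_support g1 -> continuous g2 -> bounded_support g2 ->
  (forall x,
    \int[lebesgue_measure]_s (g1 (x + s *: delta_mx ord0 i))%:E =
    \int[lebesgue_measure]_s (g2 (x + s *: delta_mx ord0 i))%:E)%E ->
  (\int[lebesgue_rV n]_x (g1 x)%:E = \int[lebesgue_rV n]_x (g2 x)%:E)%E.
Proof.
elim: n g1 g2 i => [|n IHn] g1 g2 i c1 s1 c2 s2 H; first by case: i H.
have [-> i1] := integral_lebesgue_cons c1 s1.
have [-> i2] := integral_lebesgue_cons c2 s2.
case: (unliftP ord0 i) H => [j|] -> H.
  rewrite -!integral12_prod_meas1//; apply: eq_integral => s _.
  apply: (IHn (fun v => g1 (cons_rV (s, v))) (fun v => g2 (cons_rV (s, v))) j).
  - by move=> v; apply: continuous_comp; [exact: continuous_cons_rV|exact: c1].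
  - exact: bounded_support_cons.
  - by move=> v; apply: continuous_comp; [exact: continuous_cons_rV|exact: c2].
  - exact: bounded_support_cons.
  - move=> v; under eq_integral do rewrite cons_rV_liftD.
    by rewrite H; under [RHS]eq_integral do rewrite cons_rV_liftD.
(* For the first coordinate the order of integration is reversed, so that the inner integral is the
   one over the line. *)
rewrite -!integral21_prod_meas1//; apply: eq_integral => v _.
have E (g : 'rV[R]_n.+1 -> R) s :
    g (cons_rV (s, v)) = g (cons_rV (0, v) + s *: delta_mx ord0 ord0).
  by rewrite -cons_rV0D add0r.
rewrite /fubini_G.
under eq_integral do rewrite E.
by rewrite H; under [RHS]eq_integral do rewrite E.
Qed.

Lemma dominated_convergence_bounded_support n (f_ : nat -> 'rV[R]_n -> R)
    (f : 'rV[R]_n -> R) (K B : R) :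
  (forall N, continuous (f_ N)) -> (forall x, f_ ^~ x @ \oo --> f x) ->
  (forall N x, `|f_ N x| <= K) -> (forall N x, B < `|x| -> f_ N x = 0) ->
  (\int[lebesgue_rV n]_x (f_ N x)%:E @[N --> \oo] -->
   \int[lebesgue_rV n]_x (f x)%:E)%E.
Proof.
move=> cf_ f_f f_K f_B.
have mf_ N : measurable_fun [set: 'rV[R]_n] (EFin \o f_ N).
  by apply/measurable_EFinP; exact: continuous_measurable_rV.
have eff_ x : (EFin \o f_ N) x @[N --> \oo] --> (EFin \o f) x.
  by apply: cvg_EFin; [exact: nearW|exact: f_f].
have mf : measurable_fun [set: 'rV[R]_n] (EFin \o f).
  by apply: (emeasurable_fun_cvg (fun N => EFin \o f_ N)) => // x _; exact: eff_.
have K0 : 0 <= K by apply: le_trans (f_K 0 0).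
pose G (x : 'rV[R]_n) : R := K * \1_(@box n B) x.
have iG : (lebesgue_rV n).-integrable setT (EFin \o G).
  apply: (bounded_support_integrable (A := @box n B) (M := K)).
  - exact: measurable_box.
  - exact: lebesgue_rV_box_lty.
  - by apply: measurable_funM => //; apply: measurable_indic; exact: measurable_box.
  - move=> x; rewrite /G normrM ger0_norm// ler_piMr// indicE.
    by case: (x \in _); rewrite ?normr1 ?normr0.
  - by move=> x xB; rewrite /G indicE memNset// mulr0.
have f_G x N : (`|(EFin \o f_ N) x| <= (EFin \o G) x)%E.
  rewrite /= lee_fin /G indicE.
  have [xB|xB] := boolP (x \in box B); first by rewrite mulr1.
  rewrite mulr0 f_B ?normr0// ltNge.
  by apply: contra xB => xB; rewrite inE; exact: norm_le_box.
have [_ _ ] := dominated_convergence measurableT mf_ mf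
  (aeW _ (fun x _ => eff_ x)) iG (aeW _ (fun x N _ => f_G x N)).
exact.
Qed.

End bounded_support.

(** * Calculus in one variable: primitives and change of variables *)

Section one_variable.
Context {R : realType}.
Implicit Types (f F g : R -> R).
Notation mu := (@lebesgue_measure R).

Lemma is_derive_continuous (W : normedModType R) (F f : R -> W) :
  (forall x, is_derive x (1 : R) F (f x)) ->
  continuous F.
Proof. by move=> dF x; apply/differentiable_continuous/derivable1_diffP. Qed.

(** A mean value theorem indifferent to the order of [a] and [b], so that negative times and steps
    need no separate treatment. *)
Lemma MVT_symmetric F f (a b : R) :
  (forall x, is_derive x (1 : R) F (f x)) ->
  exists2 c, `|c - a| <= `|b - a| & F b - F a = f c * (b - a).
Proof.
move=> dF; have cF := is_derive_continuous dF.
have [ab|/ltW ba] := leP a b.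
- have [c] := MVT_segment ab (fun x _ => dF x) (continuous_subspaceT cF).
  rewrite in_itv /= => /andP[ac cb] E; exists c => //.
  by rewrite !ger0_norm ?subr_ge0// lerB.
- have [c] := MVT_segment ba (fun x _ => dF x) (continuous_subspaceT cF).
  rewrite in_itv /= => /andP[bc ca] E; exists c.
    by rewrite !ler0_norm ?subr_le0// lerN2 lerB.
  by rewrite -opprB E -mulrN opprB.
Qed.

Lemma antiderivative_right f (a : R) : continuous f ->
  exists F, forall x : R, a < x -> is_derive x (1 : R) F (f x).
Proof.
move=> cf; exists (fun x => \int[mu]_(t in `[a, x]) f t) => x ax.
have int b : mu.-integrable `[a, b] (EFin \o f).
  apply: continuous_compact_integrable; first exact: segment_compact.
  exact: continuous_subspaceT.
have [dF <-] := @continuous_FTC1_closed R f a x (x + 1) (ltr_pwDr ltr01 (lexx x))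
  (int _) ax (cf x).
by rewrite derive1E; exact: derivableP.
Qed.

(** Integration from a base point yields a primitive only to the right of it. Primitives on the
    half-lines starting at [- n.+1%:R], all normalized at [0], are glued together. *)
Lemma antiderivative f : continuous f ->
  exists2 F, F 0 = 0 & forall x, is_derive x (1 : R) F (f x).
Proof.
move=> cf.
have H (n : nat) : exists F, F 0 = 0 /\
    forall x : R, - n.+1%:R < x -> is_derive x (1 : R) F (f x).
  have [F dF] := antiderivative_right (- n.+1%:R) cf.
  exists (fun x => F x - F 0); split; first by rewrite subrr.
  move=> x nx; have := dF x nx => ?.
  by apply: is_derive_eq; rewrite subr0.
pose F n := projT1 (cid (H n)).
have F0 n : F n 0 = 0 by rewrite /F; case: cid => ? [].
have dF n (x : R) : - n.+1%:R < x -> is_derive x (1 : R) (F n) (f x).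
  by move: x; rewrite /F; case: cid => ? [].
(* On the smaller half-line the difference of two pieces has zero derivative and vanishes at [0]. *)
have FE n m (x : R) : - n.+1%:R < x -> (n <= m)%N -> F n x = F m x.
  move=> nx nm.
  have nm' : - m.+1%:R <= - n.+1%:R :> R by rewrite lerN2 ler_nat.
  have n0 : - n.+1%:R < 0 :> R by rewrite oppr_lt0.
  have dD (y : R) : - n.+1%:R < y -> is_derive y (1 : R) (fun z => F n z - F m z) 0.
    move=> ny; have := dF n y ny => ?.
    have ? := dF m y (le_lt_trans nm' ny).
    by apply: is_derive_eq; rewrite subrr.
  have cD (y z : R) : - n.+1%:R < y ->
      {within `[y, z], continuous (fun z => F n z - F m z)}.
    move=> ny; apply: derivable_within_continuous => w.
    rewrite in_itv /= => /andP[yw _].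
    by have [] := dD w (lt_le_trans ny yw).
  apply/eqP; rewrite -subr_eq0; apply/eqP.
  have [x0|/ltW x0] := leP 0 x.
  - have dD0 y : y \in `]0, x[ -> is_derive y (1 : R) (fun z => F n z - F m z) 0.
      by rewrite in_itv /= => /andP[y0 _]; apply: dD; exact: lt_trans y0.
    have [c _] := @MVT_segment _ _ (fun=> 0) _ _ x0 dD0 (cD _ _ n0).
    by rewrite !F0 mul0r subrr subr0.
  - have dD0 y : y \in `]x, 0[ -> is_derive y (1 : R) (fun z => F n z - F m z) 0.
      by rewrite in_itv /= => /andP[y0 _]; apply: dD; exact: lt_trans y0.
    have [c _] := @MVT_segment _ _ (fun=> 0) _ _ x0 dD0 (cD _ _ nx).
    by rewrite !F0 mul0r subrr sub0r => /eqP; rewrite oppr_eq0 => /eqP.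
pose N (x : R) := Num.truncn `|x|.
have NP x : - (N x).+1%:R < x.
  by rewrite ltrNl (le_lt_trans (ler_norm _))// normrN truncnS_gt.
exists (fun x => F (N x) x) => [|x]; first exact: F0.
(* The index [N y] may vary with [y] near [x]; on a whole neighbourhood every piece is compared with
   the single piece of index [(N x).+1]. *)
have := dF (N x).+1 x; have xN : - (N x).+2%:R < x.
  by rewrite (lt_trans _ (NP x))// ltrN2 ltr_nat.
move/(_ xN); apply: near_eq_is_derive.
near=> y.
have yN : - (N x).+2%:R < y by near: y; exact: lt_nbhsr.
have [Nxy|/ltnW Nxy] := leqP (N x).+1 (N y).
  by rewrite (FE _ _ _ yN Nxy).
by rewrite (FE _ _ _ (NP y) Nxy).
Unshelve. all: by end_near. Qed.

Lemma integral_segment_support f (N : R) :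
  (forall x, N < `|x| -> f x = 0) ->
  (\int[mu]_x (f x)%:E = \int[mu]_(x in `[(- N)%R, N]) (f x)%:E)%E.
Proof.
move=> fN; rewrite [RHS]integral_mkcond; apply: eq_integral => x _.
rewrite patchE; case: ifPn => // /negP xN; rewrite fN// ltNge.
by apply/negP => xN'; apply: xN; rewrite inE /= in_itv /= -ler_norml.
Qed.

Lemma integral_FTC2 F f (a b : R) : a < b -> continuous f ->
  (forall x, is_derive x (1 : R) F (f x)) ->
  (\int[mu]_(x in `[a, b]) (f x)%:E = (F b)%:E - (F a)%:E)%E.
Proof.
move=> ab cf dF; have cF := is_derive_continuous dF.
apply: continuous_FTC2 => //.
- exact: continuous_subspaceT.
- split.
  + by move=> x _; have [] := dF x.
  + by apply: cvg_at_right_filter; exact: cF.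
  + by apply: cvg_at_left_filter; exact: cF.
- by move=> x _; rewrite derive1E; exact: derive_val.
Qed.

(** The map [x + b x] need not be injective: if [G] is a primitive of [g], the two integrands have
    the primitives [G (x + b x)] and [G x], and these agree far from the origin. *)
Lemma integral_change_variable g (b db : R -> R) (B M : R) :
  continuous g -> (forall x, B < `|x| -> g x = 0) ->
  continuous db -> (forall x, is_derive x (1 : R) b (db x)) ->
  (forall x, `|b x| <= M) ->
  (\int[mu]_x (g (x + b x) * (1 + db x))%:E = \int[mu]_x (g x)%:E)%E.
Proof.
move=> cg gB cdb dbb bM; have cb := is_derive_continuous dbb.
have [G _ dG] := antiderivative cg.
have M0 : 0 <= M by apply: le_trans (bM 0).
pose N := `|B| + M + 1.
have N0 : 0 < N by rewrite /N ltr_wpDl// addr_ge0.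
have BN : B + M < N by rewrite /N ltr_pwDr// lerD2r ler_norm.
have shift x : `|x| <= `|x + b x| + M.
  rewrite -[in leLHS](addrK (b x) x) (le_trans (ler_normB _ _))// lerD2l.
  exact: bM.
have dGb x : is_derive x (1 : R) (fun x => G (x + b x)) (g (x + b x) * (1 + db x)).
  have ? := dbb x; have ? := dG (x + b x).
  have ? : is_derive x (1 : R) (fun y : R => y + b y) (1 + db x).
    exact: is_deriveD.
  by apply: is_derive1_comp.
rewrite (@integral_segment_support (fun x => g (x + b x) * (1 + db x)) N); last first.
  move=> x Nx; rewrite gB ?mul0r//.
  have := shift x; move: Nx BN; lra.
rewrite (@integral_segment_support g N); last first.
  by move=> x Nx; apply: gB; move: Nx BN M0; lra.
have NN : - N < N by lra.
rewrite (@integral_FTC2 (fun x => G (x + b x)) (fun x => g (x + b x) * (1 + db x)))//.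
  rewrite (@integral_FTC2 G g)//.
  (* The segment from [x] to [x + b x] stays within [M] of [x]. Since [N] exceeds [B + M], it avoids
     the support of [g]. *)
  have Gcst x : N <= `|x| -> G (x + b x) = G x.
    move=> Nx; have [c] := MVT_symmetric x (x + b x) dG.
    rewrite [x + _]addrC addrK => cx; rewrite gB ?mul0r => [/subr0_eq//|].
    have := ler_normD c (x - c); rewrite addrC subrK distrC.
    by move: (bM x) cx Nx BN; lra.
  by rewrite !Gcst// ?normrN gtr0_norm.
move=> x; apply: cvgM; last by apply: cvgD; [exact: cvg_cst|exact: cdb].
apply: (@continuous_comp _ _ _ (fun x => x + b x) g); last exact: cg.
by apply: cvgD; [exact: cvg_id|exact: cb].
Qed.

End one_variable.

(** * Derivatives along lines and continuity of compound functions *)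

Lemma is_derive_line {R : realType} (V W : normedModType R) (f : V -> W)
    (x v : V) (s : R) l :
  is_derive (x + s *: v) v f l -> is_derive s (1 : R) (fun t : R => f (x + t *: v)) l.
Proof.
move=> [fv fl].
have E : (fun h : R => h^-1 *: (f (x + (h *: (1 : R) + s) *: v) - f (x + s *: v))) =
    (fun h : R => h^-1 *: ((f \o shift (x + s *: v)) (h *: v) - f (x + s *: v))).
  apply/funext => h /=; congr (_ *: (f _ - _)).
  by rewrite [h *: 1]mulr1 scalerDl addrCA.
split; first by rewrite /derivable /= E.
by rewrite /derive /= E.
Qed.

Lemma is_derive_translate {R : realType} (W : normedModType R) (f : R -> W) (r t : R) l :
  is_derive (r + t) (1 : R) f l -> is_derive r (1 : R) (fun s => f (s + t)) l.
Proof.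
move=> df; rewrite (_ : (fun s => _) = fun s => f (t + s *: (1 : R))).
  by apply: is_derive_line; rewrite [_ *: 1]mulr1 addrC.
by apply/funext => s; rewrite [_ *: 1]mulr1 addrC.
Qed.

Lemma continuous_translate {R : realType} (T : topologicalType)
    (V : normedModType R) (k : T -> V) (b : T -> R) (v : V) :
  continuous k -> continuous b -> continuous (fun x => k x + b x *: v).
Proof.
move=> ck cb x; apply: (@continuousD _ _ _ k (fun x => b x *: v)); first exact: ck.
by apply: continuousZr_tmp; exact: cb.
Qed.

Section pointwise_continuity.
Context {R : realType} {T : topologicalType}.
Implicit Types f g : T -> R.

Lemma continuous_cst (c : R) : continuous (fun _ : T => c).
Proof. by move=> x; exact: cvg_cst. Qed.

Lemma continuous_add f g :
  continuous f -> continuous g -> continuous (fun x => f x + g x).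
Proof. by move=> cf cg x; apply: (@continuousD _ _ _ f g); [exact: cf|exact: cg]. Qed.

Lemma continuous_mul f g :
  continuous f -> continuous g -> continuous (fun x => f x * g x).
Proof. by move=> cf cg x; apply: (@continuousM _ _ f g); [exact: cf|exact: cg]. Qed.

Lemma continuous_sum (I : Type) (r : seq I) (F : I -> T -> R) :
  (forall i, continuous (F i)) -> continuous (fun x => \sum_(i <- r) F i x).
Proof.
move=> cF; elim: r => [|i r IHr].
  by under eq_fun do rewrite big_nil; exact: continuous_cst.
by under eq_fun do rewrite big_cons; exact: continuous_add.
Qed.

Lemma continuous_compose (U W : topologicalType) (f : T -> U) (g : U -> W) :
  continuous f -> continuous g -> continuous (fun x => g (f x)).
Proof.
by move=> cf cg x; apply: (@continuous_comp _ _ _ f g); [exact: cf|exact: cg].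
Qed.

End pointwise_continuity.

(** * Shears and their exact change of variables *)

Section shears.
Context {R : realType} {n : nat}.
Implicit Types (x y : 'rV[R]_n) (g : 'rV[R]_n -> R).

(** The shear maps each line parallel to the [i]-th axis into itself, so the one-variable formula on
    every such line suffices. *)
Lemma integral_shear g (b db : 'rV[R]_n -> R) (M : R) (i : 'I_n) :
  continuous g -> bounded_support g -> continuous b -> continuous db ->
  (forall x, is_derive x (delta_mx ord0 i) b (db x)) ->
  (forall x, `|b x| <= M) ->
  (\int[lebesgue_rV n]_x (g (x + b x *: delta_mx ord0 i) * (1 + db x))%:E =
   \int[lebesgue_rV n]_x (g x)%:E)%E.
Proof.
move=> cg sg cb cdb dbb bM; have [B gB] := sg.
have bde x : `|b x *: (delta_mx ord0 i : 'rV[R]_n)| <= M.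
  by rewrite normrZ (le_trans _ (bM x))// ler_piMr// norm_delta_rV.
have csb : continuous (fun x => g (x + b x *: delta_mx ord0 i)).
  apply: (@continuous_compose _ _ _ (fun x => x + b x *: delta_mx ord0 i) g) => //.
  by apply: (@continuous_translate _ _ _ id) => // y; exact: cvg_id.
apply: (@eq_integral_lines _ _ (fun x => g (x + b x *: delta_mx ord0 i) * (1 + db x))
  g i) => //.
- by apply: continuous_mul => //; apply: continuous_add => //; exact: continuous_cst.
- exists (B + M) => x Bx; rewrite gB ?mul0r//.
  have := ler_normB (x + b x *: delta_mx ord0 i) (b x *: delta_mx ord0 i).
  by rewrite addrK; move: (bde x) Bx; lra.
- move=> x.
  pose ln (s : R) := x + s *: (delta_mx ord0 i : 'rV[R]_n).
  have cln : continuous ln.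
    apply: (@continuous_translate _ _ _ (fun=> x) id) => y; first exact: cvg_cst.
    exact: cvg_id.
  have cl (W : normedModType R) (f : 'rV[R]_n -> W) : continuous f ->
    continuous (fun s => f (ln s)) by apply: continuous_compose.
  under eq_integral do rewrite -addrA -scalerDl.
  apply: (@integral_change_variable _ (fun s => g (ln s)) (fun s => b (ln s))
    (fun s => db (ln s)) (`|B| + `|x|) M).
  + exact: cl.
  (* The parameter [s] differs from the [i]-th coordinate of [ln s] by that of [x]; hence the bound
     enlarged by the norm of [x]. *)
  + move=> s Bs; apply: gB.
    have := coord_le_norm (ln s) i; rewrite !mxE !eqxx mulr1.
    have := ler_normB (x ord0 i + s) (x ord0 i); rewrite [x ord0 i + s]addrC addrK.
    by move: (coord_le_norm x i) (ler_norm B) Bs; lra.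
  + exact: cl.
  + by move=> s; apply: is_derive_line; exact: dbb.
  + by move=> s; exact: bM.
Qed.

(** [db i] is the diagonal derivative of [b i] in direction [i], so that the sum of the [db i] is
    the divergence. A single constant [M] serves for all bounds, which keeps the error estimates in
    powers of [|h| * M]. *)
Record bounded_C1_field (b db : 'I_n -> 'rV[R]_n -> R) (M : R) : Prop := {
  field_bound_ge0 : 0 <= M ;
  field_bounded : forall i x, `|b i x| <= M ;
  field_lipschitz : forall i x y, `|b i x - b i y| <= M * `|x - y| ;
  field_derive : forall i x, is_derive x (delta_mx ord0 i) (b i) (db i x) ;
  field_derive_continuous : forall i, continuous (db i) ;
  field_derive_bounded : forall i x, `|db i x| <= M }.

Variables (b db : 'I_n -> 'rV[R]_n -> R) (M : R).
Hypothesis regular : bounded_C1_field b db M.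
Let M0 := field_bound_ge0 regular.
Let bM := field_bounded regular.
Let bL := field_lipschitz regular.
Let cdb := field_derive_continuous regular.

Definition shear_step (h : R) x (i : 'I_n) := x + (h * b i x) *: delta_mx ord0 i.

Definition shears h := foldl (shear_step h).

(* The Jacobian determinant of [fun x => shears h x l]: each step moves a single
   coordinate, so its Jacobian matrix is triangular. *)
Fixpoint shears_weight h x (l : seq 'I_n) : R :=
  if l is i :: l' then (1 + h * db i x) * shears_weight h (shear_step h x i) l'
  else 1.

Let cb i : continuous (b i).
Proof. exact: lipschitz_continuous_rV (bL i). Qed.

Let chb h i : continuous (fun x => h * b i x).
Proof. by apply: continuous_mul => //; exact: continuous_cst. Qed.

Let chdb h i : continuous (fun x => h * db i x).
Proof. by apply: continuous_mul => //; exact: continuous_cst. Qed.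

Lemma continuous_shear_step h i : continuous (fun x => shear_step h x i).
Proof. by apply: (@continuous_translate _ _ _ id) => // y; exact: cvg_id. Qed.

Lemma continuous_shears h l : continuous (fun x => shears h x l).
Proof.
elim: l => [|i l IHl] /=; first by move=> x; exact: cvg_id.
apply: (@continuous_compose _ _ _ (fun x => shear_step h x i)
  (fun x => shears h x l)) => //.
exact: continuous_shear_step.
Qed.

Lemma continuous_shears_weight h l : continuous (fun x => shears_weight h x l).
Proof.
elim: l => [|i l IHl] /=; first exact: continuous_cst.
apply: continuous_mul.
  by apply: continuous_add => //; exact: continuous_cst.
apply: (@continuous_compose _ _ _ (fun x => shear_step h x i)
  (fun x => shears_weight h x l)) => //.
exact: continuous_shear_step.
Qed.

Lemma norm_shear_stepB h x i : `|shear_step h x i - x| <= `|h| * M.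
Proof.
rewrite addrAC subrr add0r normrZ (@le_trans _ _ `|h * b i x|)//.
  by rewrite ler_piMr// norm_delta_rV.
by rewrite normrM ler_wpM2l.
Qed.

Lemma norm_shearsB h x l : `|shears h x l - x| <= (size l)%:R * (`|h| * M).
Proof.
elim: l x => [|i l IHl] x /=; first by rewrite subrr normr0 mul0r.
rewrite (le_trans (ler_distD (shear_step h x i) _ _))// -natr1 mulrDl mul1r.
by rewrite lerD// ?IHl// norm_shear_stepB.
Qed.

Lemma bounded_support_displacement g (k : 'rV[R]_n -> 'rV[R]_n) (C : R) :
  bounded_support g -> (forall x, `|k x - x| <= C) ->
  bounded_support (fun x => g (k x)).
Proof.
move=> [B gB] kC; exists (B + C) => x Bx; apply: gB.
by have := ler_normD (k x) (x - k x); rewrite subrKC distrC; move: (kC x) Bx; lra.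
Qed.

(** Induction peels off the first shear: [integral_shear] is applied to the product of [g] after the
    remaining shears and their weight. *)
Lemma integral_shears h l g : continuous g -> bounded_support g ->
  (\int[lebesgue_rV n]_x (g (shears h x l) * shears_weight h x l)%:E =
   \int[lebesgue_rV n]_x (g x)%:E)%E.
Proof.
move=> cg sg; elim: l => [|i l IHl].
  by under eq_integral do rewrite /= mulr1.
rewrite -IHl.
under eq_integral do rewrite /= [(1 + _) * _]mulrC mulrA.
apply: (@integral_shear (fun x => g (shears h x l) * shears_weight h x l)
  (fun x => h * b i x) (fun x => h * db i x) (`|h| * M)) => //.
- apply: continuous_mul; last exact: continuous_shears_weight.
  apply: (@continuous_compose _ _ _ (fun x => shears h x l) g) => //.
  exact: continuous_shears.
- have [B gB] := bounded_support_displacement sg (norm_shearsB h ^~ l).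
  by exists B => x Bx; rewrite gB// mul0r.
- move=> x.
  exact: (@is_deriveZ _ _ _ (b i) h x _ (db i x) (field_derive regular i x)).
- by move=> x; rewrite normrM ler_wpM2l.
Qed.

End shears.

(** * Convergence of the splitting scheme *)

(* [(1 + a) (1 - a + 2 a^2) = 1 + a^2 (1 + 2 a) >= 1]. *)
Lemma expR_le1Dx (R : realType) (a : R) : - 2^-1 <= a ->
  expR (a - 2 * a ^+ 2) <= 1 + a.
Proof.
move=> a2; rewrite -[a - _]opprB expRN.
have h1 : 0 < 1 + (2 * a ^+ 2 - a) by have := sqr_ge0 (2 * a - 2^-1); nra.
have a1 : 0 < 1 + a by lra.
have := expR_ge1Dx (2 * a ^+ 2 - a) => h2.
rewrite -[leRHS]invrK lef_pV2 ?posrE ?expR_gt0 ?invr_gt0//.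
rewrite (le_trans _ h2)// -[leLHS]mul1r ler_pdivrMr//.
have : 0 <= a ^+ 2 * (1 + 2 * a) by rewrite mulr_ge0 ?sqr_ge0//; lra.
by nra.
Qed.

Lemma is_derive_coord {R : realType} n (c : R -> 'rV[R]_n) (t : R) dc i :
  is_derive t (1 : R) c dc -> is_derive t (1 : R) (fun s => c s ord0 i) (dc ord0 i).
Proof.
move=> [dc1 <-]; have dci := (derivable_mxP _ _ _).1 dc1 ord0 i.
split => //; rewrite derive_mx// mxE.
by [].
Qed.

Section shears_convergence.
Context {R : realType} {n : nat}.
Implicit Types (x y : 'rV[R]_n) (g : 'rV[R]_n -> R) (h t : R).
Variables (b db : 'I_n -> 'rV[R]_n -> R) (M : R).
Hypothesis regular : bounded_C1_field b db M.
Let M0 := field_bound_ge0 regular.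
Let bM := field_bounded regular.
Let bL := field_lipschitz regular.
Let cdb := field_derive_continuous regular.
Let dbM := field_derive_bounded regular.
Local Notation step := (shear_step b).
Local Notation shears := (shears b).
Local Notation weight := (shears_weight b db).

Definition integral_curve (c : R -> 'rV[R]_n) :=
  forall t, is_derive t (1 : R) c (\row_i b i (c t)).

(* One pass through all coordinates is an order-one splitting scheme for the
   flow of the field. *)
Definition sweeps k : seq 'I_n := flatten (nseq k (enum 'I_n)).

Lemma sweepsS k : sweeps k.+1 = sweeps k ++ enum 'I_n.
Proof. by rewrite /sweeps -addn1 nseqD flatten_cat /= cats0. Qed.

Lemma size_sweeps k : size (sweeps k) = (k * n)%N.
Proof.
by elim: k => // k IHk; rewrite sweepsS size_cat IHk size_enum_ord mulSn addnC.
Qed.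

Lemma shears_cat h x l l' : shears h x (l ++ l') = shears h (shears h x l) l'.
Proof. exact: foldl_cat. Qed.

(** A step moves the point by at most [|h| * M], so by the Lipschitz bound it alters each later
    increment by at most [(|h| * M) ^+ 2]. Summing over pairs of steps gives the squared length. *)
Lemma shears_consistent h x l :
  `|shears h x l - x - \sum_(i <- l) (h * b i x) *: delta_mx ord0 i| <=
  (size l)%:R ^+ 2 * (`|h| * M) ^+ 2.
Proof.
elim: l x => [|i l IHl] x.
  by rewrite /= big_nil !subrr normr0 expr0n /= mul0r.
rewrite /= big_cons; set y := step h x i.
have -> : shears h y l - x - ((h * b i x) *: delta_mx ord0 i +
      \sum_(j <- l) (h * b j x) *: delta_mx ord0 j) =
    (shears h y l - y - \sum_(j <- l) (h * b j y) *: delta_mx ord0 j) +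
    \sum_(j <- l) (h * (b j y - b j x)) *: delta_mx ord0 j.
  under [X in _ = _ + X]eq_bigr do rewrite mulrBr scalerBl.
  rewrite sumrB addrA subrK opprD addrA; congr (_ - _).
  by rewrite /y /shear_step opprD addrA.
rewrite (le_trans (ler_normD _ _))//.
have H : `|\sum_(j <- l) (h * (b j y - b j x)) *: (delta_mx ord0 j : 'rV[R]_n)| <=
    (size l)%:R * (`|h| * M) ^+ 2.
  rewrite (le_trans (ler_norm_sum _ _ _))// -sum1_size natr_sum mulr_suml.
  apply: ler_sum => j _; rewrite mul1r normrZ (@le_trans _ _ `|h * (b j y - b j x)|)//.
    by rewrite ler_piMr// norm_delta_rV.
  rewrite normrM expr2 -mulrA ler_wpM2l// (le_trans (bL _ _ _))// ler_wpM2l//.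
  exact: (norm_shear_stepB regular).
rewrite (le_trans (lerD (IHl y) H))// -mulrDl ler_wpM2r ?sqr_ge0//.
by rewrite -natr1; have : 0 <= (size l)%:R :> R by []; nra.
Qed.

Lemma sweep_consistent h x :
  `|shears h x (enum 'I_n) - x - h *: \row_i b i x| <=
  n%:R ^+ 2 * (`|h| * M) ^+ 2.
Proof.
have := shears_consistent h x (enum 'I_n); rewrite size_enum_ord.
rewrite big_enum /= (_ : \sum_(i | _) _ = h *: \row_i b i x)//.
rewrite [in RHS](row_sum_delta (\row_i b i x)) scaler_sumr.
by apply: eq_bigr => i _; rewrite mxE scalerA.
Qed.

(** Each step has Lipschitz constant [1 + |h| * M], which is at most [expR (|h| * M)]. *)
Lemma shears_lipschitz h x y l :
  `|shears h x l - shears h y l| <= expR ((size l)%:R * (`|h| * M)) * `|x - y|.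
Proof.
elim: l x y => [|i l IHl] x y /=; first by rewrite mul0r expR0 mul1r.
rewrite (le_trans (IHl _ _))// -natr1 mulrDl mul1r expRD -mulrA ler_wpM2l ?expR_ge0//.
have -> : step h x i - step h y i = (x - y) + (h * (b i x - b i y)) *: delta_mx ord0 i.
  by rewrite /shear_step mulrBr scalerBl opprD addrACA.
rewrite (le_trans (ler_normD _ _))//.
have : `|(h * (b i x - b i y)) *: (delta_mx ord0 i : 'rV[R]_n)| <= `|h| * M * `|x - y|.
  rewrite normrZ (@le_trans _ _ `|h * (b i x - b i y)|)//.
    by rewrite ler_piMr// norm_delta_rV.
  by rewrite normrM -mulrA ler_wpM2l.
move/(lerD (lexx `|x - y|)) => /le_trans; apply.
by rewrite -{1}[`|x - y|]mul1r -mulrDl ler_wpM2r// expR_ge1Dx.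
Qed.

(** The mean value theorem is applied coordinate by coordinate; in the sup norm it does not matter
    that the intermediate times differ. *)
Lemma integral_curve_lipschitz c (s t : R) :
  integral_curve c -> `|c t - c s| <= M * `|t - s|.
Proof.
move=> dc; apply: norm_rV_le => [|i]; first by rewrite mulr_ge0.
have dci r : is_derive r (1 : R) (fun z => c z ord0 i) (b i (c r)).
  by have := is_derive_coord i (dc r); rewrite mxE.
have [r _ E] := MVT_symmetric s t dci.
by rewrite !mxE E normrM ler_wpM2r.
Qed.

Lemma integral_curve_consistent c (s h : R) : integral_curve c ->
  `|c (s + h) - c s - h *: \row_i b i (c s)| <= (`|h| * M) ^+ 2.
Proof.
move=> dc; apply: norm_rV_le => [|i]; first exact: sqr_ge0.
have dci r : is_derive r (1 : R) (fun z => c z ord0 i) (b i (c r)).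
  by have := is_derive_coord i (dc r); rewrite mxE.
have [r rs E] := MVT_symmetric s (s + h) dci.
rewrite !mxE E (addrC s) addrK mulrC -mulrBr normrM.
rewrite (addrC s) addrK in rs.
have h1 : `|b i (c r) - b i (c s)| <= M * (M * `|h|).
  rewrite (le_trans (bL _ _ _))// ler_wpM2l//.
  by rewrite (le_trans (integral_curve_lipschitz _ _ dc))// ler_wpM2l.
apply: (le_trans (ler_wpM2l (normr_ge0 h) h1)).
by rewrite le_eqVlt; apply/orP; left; apply/eqP; ring.
Qed.

(** Consistency plus stability: each sweep commits an error of order [h ^+ 2], and the Lipschitz
    bound controls how later sweeps amplify it. The new sweep is compared with the one started from
    the exact point [z]. *)
Lemma sweeps_error c (h : R) k : integral_curve c ->
  `|shears h (c 0) (sweeps k) - c (k%:R * h)| <=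
  k%:R * (n%:R ^+ 2 + 1) * (`|h| * M) ^+ 2 * expR ((k * n)%:R * (`|h| * M)).
Proof.
move=> dc; elim: k => [|k IHk].
  by rewrite /= !mul0r subrr normr0.
rewrite sweepsS shears_cat; set y := shears h (c 0) (sweeps k) in IHk *.
set z := c (k%:R * h) in IHk *.
have -> : c (k.+1%:R * h) = c (k%:R * h + h) by rewrite -natr1 mulrDl mul1r.
have h1 := shears_lipschitz h y z (enum 'I_n).
have h2 := sweep_consistent h z.
have h3 := integral_curve_consistent (k%:R * h) h dc.
rewrite size_enum_ord -/z in h1 h2 h3.
rewrite mulSn natrD mulrDl expRD.
set E := expR (n%:R * _) in h1 *; set Ek := expR ((k * n)%:R * _) in IHk *.
set C := (`|h| * M) ^+ 2 in h2 h3 IHk *.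
have E1 : 1 <= E by rewrite -expR0 ler_expR !mulr_ge0.
have Ek1 : 1 <= Ek by rewrite -expR0 ler_expR !mulr_ge0.
have C0 : 0 <= C by exact: sqr_ge0.
have h4 : `|shears h z (enum 'I_n) - c (k%:R * h + h)| <= (n%:R ^+ 2 + 1) * C.
  set w := shears h z _ in h2 *; set v := c (_ + h) in h3 *.
  have -> : w - v = (w - z - h *: \row_i b i z) - (v - z - h *: \row_i b i z).
    by rewrite opprB addrA subrK opprB addrA subrK.
  by rewrite (le_trans (ler_normB _ _))// mulrDl mul1r lerD.
rewrite (le_trans (ler_distD (shears h z (enum 'I_n)) _ _))//.
rewrite (le_trans (lerD h1 h4))//.
have h5 := ler_wpM2l (le_trans ler01 E1) IHk.
rewrite (le_trans (lerD h5 (lexx _)))// -natr1.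
(* The new local error is put under the same exponential factor as the propagated ones. *)
have EE : 1 <= E * Ek by nra.
set D := n%:R ^+ 2 + 1.
have D0 : 0 <= D * C by rewrite mulr_ge0// addr_ge0// sqr_ge0.
have -> : (k%:R + 1) * D * C * (E * Ek) = E * (k%:R * D * C * Ek) + D * C * (E * Ek).
  by ring.
by rewrite lerD2l ler_peMr.
Qed.

End shears_convergence.

(** * Convergence of the weights to the exponential of the integrated divergence *)

Section weights_convergence.
Context {R : realType} {n : nat}.
Implicit Types (x y : 'rV[R]_n) (g : 'rV[R]_n -> R) (h t : R).
Variables (b db : 'I_n -> 'rV[R]_n -> R) (M : R).
Hypothesis regular : bounded_C1_field b db M.
Let M0 := field_bound_ge0 regular.
Let dbM := field_derive_bounded regular.
Local Notation step := (shear_step b).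
Local Notation shears := (shears b).
Local Notation weight := (shears_weight b db).

(** The first-order part of the logarithm of [shears_weight]. *)
Fixpoint shears_div h x (l : seq 'I_n) : R :=
  if l is i :: l' then h * db i x + shears_div h (step h x i) l' else 0.

Lemma shears_div_cat h x l l' :
  shears_div h x (l ++ l') = shears_div h x l + shears_div h (shears h x l) l'.
Proof. by elim: l x => [|i l IHl] x /=; rewrite ?add0r// IHl addrA. Qed.

Lemma norm_shears_weight h x l :
  `|weight h x l| <= expR ((size l)%:R * (`|h| * M)).
Proof.
elim: l x => [|i l IHl] x /=; first by rewrite mul0r expR0 normr1.
rewrite -[(size l).+1%:R]natr1 [(_ + 1) * _]mulrDl mul1r expRD.
rewrite [(1 + _) * _]mulrC normrM ler_pM//.
rewrite (le_trans (ler_normD _ _))// normr1 (le_trans _ (expR_ge1Dx _))//.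
by rewrite lerD2l normrM ler_wpM2l.
Qed.

Let hdb_ge h x i : `|h| * M <= 2^-1 -> - 2^-1 <= h * db i x.
Proof.
move=> hM; have : `|h * db i x| <= 2^-1.
  by rewrite normrM (le_trans _ hM)// ler_wpM2l.
by rewrite ler_norml => /andP[].
Qed.

(** Factor by factor, [1 + a] lies between [expR (a - 2 * a ^+ 2)] and [expR a]; the smallness of
    [h] keeps [a] above [- 1 / 2], as the lower bound demands. *)
Lemma shears_weight_bounds h x l : `|h| * M <= 2^-1 ->
  expR (shears_div h x l - (size l)%:R * (2 * (`|h| * M) ^+ 2)) <= weight h x l
  <= expR (shears_div h x l).
Proof.
move=> hM; elim: l x => [|i l IHl] x /=; first by rewrite mul0r subr0 expR0 lexx.
have /andP[l1 l2] := IHl (step h x i).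
have a2 := hdb_ge x i hM; apply/andP; split; last first.
  rewrite expRD ler_pM ?expR_ge1Dx//; first by lra.
  by rewrite (le_trans _ l1)// expR_ge0.
rewrite -natr1 mulrDl mul1r opprD [- _ - _]addrC addrACA expRD.
rewrite ler_pM ?expR_ge0//; apply: (le_trans _ (expR_le1Dx a2)).
rewrite ler_expR lerD2l lerN2 ler_pM2l// -[leLHS]real_normK ?num_real//.
by rewrite ler_pXn2r ?nnegrE ?mulr_ge0// normrM ler_wpM2l.
Qed.

(** The intermediate points never leave the ball of radius [r] about [z], so each derivative may be
    replaced by its value at [z] at a cost of [e]. *)
Lemma shears_div_near (e r : R) h x z l :
  (forall i y, `|z - y| < r -> `|db i z - db i y| <= e) ->
  `|z - x| + (size l)%:R * (`|h| * M) < r ->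
  `|shears_div h x l - \sum_(i <- l) h * db i z| <= (size l)%:R * (`|h| * e).
Proof.
move=> zr; elim: l x => [|i l IHl] x /= zxr.
  by rewrite big_nil subrr normr0 mul0r.
rewrite big_cons opprD addrACA -natr1 mulrDl mul1r addrC.
rewrite -natr1 mulrDl mul1r in zxr.
have hM : 0 <= `|h| * M by rewrite mulr_ge0.
have lM : 0 <= (size l)%:R * (`|h| * M) by rewrite mulr_ge0.
rewrite (le_trans (ler_normD _ _))// lerD//.
  apply: IHl; have := ler_distD x z (step h x i).
  have := norm_shear_stepB regular h x i; rewrite (distrC (step h x i) x).
  by move: zxr; lra.
rewrite -mulrBr normrM ler_wpM2l// distrC zr//.
by move: zxr; lra.
Qed.

(** Over one time step [P] grows by [h] times the divergence at some intermediate point [c s], while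
    the sweep adds nearly the same amount because it starts close to [c s]. *)
Lemma sweeps_div_error (c : R -> 'rV[R]_n) (P : R -> R) (e r T E : R) h k :
  integral_curve b c -> P 0 = 0 ->
  (forall s, is_derive s (1 : R) P (\sum_i db i (c s))) ->
  (forall s, `|s| <= T -> forall i y, `|c s - y| < r -> `|db i (c s) - db i y| <= e) ->
  k%:R * `|h| <= T ->
  (forall j, (j <= k)%N -> `|shears h (c 0) (sweeps j) - c (j%:R * h)| <= E) ->
  E + (n.+1)%:R * (`|h| * M) < r ->
  `|shears_div h (c 0) (sweeps k) - P (k%:R * h)| <= k%:R * (n%:R * (`|h| * e)).
Proof.
move=> dc P0 dP near kT kE Er; elim: k kT kE => [|k IHk] kT kE.
  by rewrite /= !mul0r P0 subrr normr0.
rewrite sweepsS shears_div_cat.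
have hk : k.+1%:R * h = k%:R * h + h by rewrite -natr1 mulrDl mul1r.
have [s sk Ps] := MVT_symmetric (k%:R * h) (k%:R * h + h) dP.
rewrite (addrC (k%:R * h)) addrK in sk Ps.
have sT : `|s| <= T.
  rewrite (le_trans _ kT)// -natr1 mulrDl mul1r.
  have := ler_normD (k%:R * h) (s - k%:R * h); rewrite addrC subrK.
  by rewrite [`|_ * h|]normrM ger0_norm//; move: sk; lra.
have hyp := near s sT.
set x := shears h (c 0) (sweeps k).
have cx : `|c s - x| <= E + `|h| * M.
  rewrite (le_trans (ler_distD (c (k%:R * h)) _ _))// addrC lerD//.
    by rewrite distrC kE.
  by rewrite (le_trans (integral_curve_lipschitz regular _ _ dc))// mulrC ler_wpM2r.
have := @shears_div_near e r h x (c s) (enum 'I_n) hyp.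
rewrite size_enum_ord big_enum /= -mulr_sumr => near_x.
have {}near_x : `|shears_div h x (enum 'I_n) - h * \sum_i db i (c s)| <=
    n%:R * (`|h| * e).
  (* Of the [n.+1] displacements allowed by [Er], one accounts for the passage from [c (k%:R * h)]
     to [c s] and [n] for the sweep. *)
  by apply: near_x; move: Er cx; rewrite -natr1 mulrDl mul1r; lra.
have {}IHk : `|shears_div h (c 0) (sweeps k) - P (k%:R * h)| <=
    k%:R * (n%:R * (`|h| * e)).
  apply: IHk => [|j jk]; last by apply: kE; exact: ltnW.
  by rewrite (le_trans _ kT)// ler_wpM2r// ler_nat.
rewrite hk.
have -> : P (k%:R * h + h) = P (k%:R * h) + h * \sum_i db i (c s).
  by rewrite [h * _]mulrC -Ps subrKC [h + _]addrC.
rewrite -natr1 mulrDl mul1r opprD addrACA.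
by rewrite (le_trans (ler_normD _ _))// lerD.
Qed.

Lemma field_derive_unif_continuous (B e : R) : 0 < e ->
  exists2 r : R, 0 < r & forall x y i, `|x| <= B -> `|x - y| < r ->
    `|db i x - db i y| <= e.
Proof.
move=> e0.
have : \forall r \near (0 : R)^'+, forall i x y, `|x| <= B -> `|x - y| < r ->
    `|db i x - db i y| <= e.
  apply: filter_forall => i.
  have cdbi : continuous (db i) by exact: (field_derive_continuous regular).
  have [r r0 Hr] := compact_unif_continuous (@compact_norm_le R n B) cdbi e0.
  near=> s => x y xB xy; apply/ltW/Hr => //; apply: lt_trans xy _.
  by near: s; exact: nbhs_right_lt.
move=> H; near (0 : R)^'+ => r.
exists r => // x y i; move: i x y; near: r; exact: H.
Unshelve. all: by end_near. Qed.

Section limits.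
Variables (c : R -> 'rV[R]_n) (P : R -> R).
Hypotheses (dc : integral_curve b c) (P0 : P 0 = 0).
Hypothesis dP : forall s, is_derive s (1 : R) P (\sum_i db i (c s)).
Variable t : R.

(** [N.+1] sweeps with this step cover the time [t]; the successor keeps the divisor nonzero. *)
Let h N : R := t / N.+1%:R.

Let hE N : N.+1%:R * h N = t.
Proof. by rewrite /h mulrCA mulfV ?mulr1. Qed.

Let normhE N : N.+1%:R * `|h N| = `|t|.
Proof. by rewrite -[N.+1%:R]gtr0_norm ?ltr0n// -normrM hE. Qed.

Let hME N : `|h N| * M = `|t| * M / N.+1%:R.
Proof. by rewrite -(normhE N); field; rewrite addrC natr1. Qed.

Let C := (n%:R ^+ 2 + 1) * (`|t| * M) ^+ 2 * expR (n%:R * (`|t| * M)).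

Let C0 : 0 <= C.
Proof. by rewrite !mulr_ge0 ?expR_ge0 ?addr_ge0 ?sqr_ge0. Qed.

(** At most [N.+1] local errors of order [1 / (N + 1) ^ 2] accumulate, and the amplification factor
    is bounded independently of [N]. *)
Lemma sweeps_error_uniform N j : (j <= N.+1)%N ->
  `|shears (h N) (c 0) (sweeps j) - c (j%:R * h N)| <= C / N.+1%:R.
Proof.
move=> jN; rewrite (le_trans (sweeps_error regular _ _ dc))//.
have jN' : j%:R <= N.+1%:R :> R by rewrite ler_nat.
have q0 : 0 <= `|h N| * M by rewrite mulr_ge0.
have tq : `|t| * M = N.+1%:R * (`|h N| * M) by rewrite mulrA normhE.
have E : expR ((j * n)%:R * (`|h N| * M)) <= expR (n%:R * (`|t| * M)).
  by rewrite ler_expR tq natrM mulrAC [leLHS]mulrC ler_wpM2l// ler_wpM2r.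
have -> : C / N.+1%:R = N.+1%:R * (n%:R ^+ 2 + 1) * (`|h N| * M) ^+ 2 *
    expR (n%:R * (`|t| * M)).
  by rewrite /C {1}tq; field; rewrite addrC natr1.
rewrite ler_pM ?expR_ge0 ?mulr_ge0 ?sqr_ge0 ?addr_ge0//.
by rewrite ler_wpM2r ?sqr_ge0// ler_wpM2r// addr_ge0 ?sqr_ge0.
Qed.

Lemma cvg_div_nat (K : R) : (K / N.+1%:R) @[N --> \oo] --> (0 : R).
Proof.
rewrite -[X in _ --> X](mulr0 K); apply: cvgM; first exact: cvg_cst.
exact: cvg_harmonic.
Qed.

Lemma shears_cvg :
  shears (h N) (c 0) (sweeps N.+1) @[N --> \oo] --> c t.
Proof.
suff : forall e : R, 0 < e ->
    \forall N \near \oo, `|c t - shears (h N) (c 0) (sweeps N.+1)| < e.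
  by move=> /cvgrPdist_lt.
move=> e e0; near=> N; rewrite distrC -{1}(hE N).
rewrite (le_lt_trans (sweeps_error_uniform _))//.
near: N; exact: cvgr_lt (cvg_div_nat C) _ e0.
Unshelve. all: by end_near. Qed.

Lemma shears_div_cvg :
  shears_div (h N) (c 0) (sweeps N.+1) @[N --> \oo] --> P t.
Proof.
apply/cvgrPdist_le => e e0.
(* The accumulated error will be [n%:R * |t| * e']; adding [1] avoids a zero divisor. *)
pose e' := e / (n%:R * `|t| + 1).
have d0 : 0 < n%:R * `|t| + 1 by rewrite ltr_wpDl// mulr_ge0.
have e'0 : 0 < e' by rewrite divr_gt0.
(* The speed is at most [M], so up to time [|t|] the curve stays in the ball of this radius. *)
have [r r0 Hr] := field_derive_unif_continuous (`|c 0| + M * `|t|) e'0.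
near=> N.
have := @sweeps_div_error c P e' r `|t| (C / N.+1%:R) (h N) N.+1 dc P0 dP.
rewrite normhE hE distrC => H; apply: (le_trans (H _ _ _ _)) => //.
- move=> s st i y; apply: Hr.
  have := ler_normD (c 0) (c s - c 0); rewrite subrKC => /le_trans; apply.
  rewrite lerD2l (le_trans (integral_curve_lipschitz regular _ _ dc))// subr0.
  by rewrite ler_wpM2l.
- exact: sweeps_error_uniform.
- rewrite hME [X in _ + X]mulrA -mulrDl.
  near: N; exact: cvgr_lt (cvg_div_nat _) _ r0.
- rewrite (_ : _ * (_ * _) = n%:R * `|t| * e'); last by rewrite -(normhE N); ring.
  by rewrite /e' mulrA ler_pdivrMr// mulrC ler_wpM2l ?lerDl// ltW.
Unshelve. all: by end_near. Qed.

(** Squeezing between two exponentials: the quadratic corrections, summed over all steps, are of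
    order [1 / (N + 1)]. *)
Lemma shears_weight_cvg :
  weight (h N) (c 0) (sweeps N.+1) @[N --> \oo] --> expR (P t).
Proof.
have near_bounds : \forall N \near \oo,
    expR (shears_div (h N) (c 0) (sweeps N.+1) -
      n%:R * (2 * (`|t| * M) ^+ 2) / N.+1%:R) <= weight (h N) (c 0) (sweeps N.+1) <= expR (shears_div (h N) (c 0) (sweeps N.+1)).
  near=> N.
  have hM : `|h N| * M <= 2^-1.
    rewrite hME; apply: ltW; near: N; exact: cvgr_lt (cvg_div_nat _) _ _.
  have := shears_weight_bounds (c 0) (sweeps N.+1) hM.
  rewrite size_sweeps (_ : (_ * n)%:R * _ = n%:R * (2 * (`|t| * M) ^+ 2) / N.+1%:R)//.
  by rewrite -(normhE N) natrM; field; rewrite addrC natr1.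
apply: (squeeze_cvgr near_bounds).
- apply: continuous_cvg; first exact: continuous_expR.
  rewrite -[X in _ --> X]subr0; apply: cvgB; first exact: shears_div_cvg.
  exact: cvg_div_nat.
- by apply: continuous_cvg; [exact: continuous_expR|exact: shears_div_cvg].
Unshelve. all: by end_near. Qed.

End limits.
End weights_convergence.

(** * Stability of the flow and Liouville's formula *)

Section flow.
Context {R : realType} {n : nat}.
Implicit Types (x y : 'rV[R]_n) (g : 'rV[R]_n -> R) (t : R).
Variables (b db : 'I_n -> 'rV[R]_n -> R) (M : R).
Hypothesis regular : bounded_C1_field b db M.
Let M0 := field_bound_ge0 regular.

(** The Lipschitz bound of the sweeps is uniform in [N] and passes to the limit. This plays the part
    of Gronwall's inequality: uniqueness, the semigroup law and continuity of the flow follow. *)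
Lemma integral_curve_stable (c c' : R -> 'rV[R]_n) t :
  integral_curve b c -> integral_curve b c' ->
  `|c t - c' t| <= expR (n%:R * (`|t| * M)) * `|c 0 - c' 0|.
Proof.
move=> dc dc'.
apply/ler_addgt0Pr => e e0; have e20 : 0 < e / 2 by rewrite divr_gt0.
near \oo => N.
have h1 : `|c t - shears b (t / N.+1%:R) (c 0) (sweeps N.+1)| < e / 2.
  near: N; have /cvgrPdist_lt := shears_cvg regular dc (t := t); exact.
have h2 : `|c' t - shears b (t / N.+1%:R) (c' 0) (sweeps N.+1)| < e / 2.
  near: N; have /cvgrPdist_lt := shears_cvg regular dc' (t := t); exact.
have h3 := shears_lipschitz regular (t / N.+1%:R) (c 0) (c' 0) (sweeps N.+1).
rewrite size_sweeps normrM normfV [`|N.+1%:R|]ger0_norm// in h3.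
rewrite (_ : (_ * n)%:R * _ = n%:R * (`|t| * M)) in h3; last first.
  by rewrite natrM; field; rewrite addrC natr1.
set S := fun x => shears b (t / N.+1%:R) x (sweeps N.+1).
rewrite -/(S (c 0)) in h1 h3; rewrite -/(S (c' 0)) in h2 h3.
have := ler_distD (S (c 0)) (c t) (c' t).
have := ler_distD (S (c' 0)) (S (c 0)) (c' t).
by rewrite (distrC (S (c' 0)) (c' t)); move: h1 h2 h3; lra.
Unshelve. all: by end_near. Qed.

Variable X : R -> 'rV[R]_n -> 'rV[R]_n.
Hypothesis X0 : forall x, X 0 x = x.
Hypothesis dX : forall x, integral_curve b (X ^~ x).

Lemma flow_unique c t : integral_curve b c -> c t = X t (c 0).
Proof.
move=> dc; apply/eqP; rewrite -subr_eq0 -normr_le0.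
rewrite (le_trans (integral_curve_stable _ dc (dX (c 0))))//.
by rewrite X0 subrr normr0 mulr0.
Qed.

Lemma flow_semigroup s t x : X (s + t) x = X s (X t x).
Proof.
have d : integral_curve b (fun r => X (r + t) x).
  by move=> r; apply: (is_derive_translate (f := X ^~ x)); exact: dX.
have := flow_unique s d; rewrite add0r; exact.
Qed.

Lemma continuous_flow t : continuous (X t).
Proof.
apply: (@lipschitz_continuous_rV _ _ _ _ (expR (n%:R * (`|t| * M)))) => x y.
by have := integral_curve_stable t (dX x) (dX y); rewrite !X0.
Qed.

Variable P : 'rV[R]_n -> R -> R.
Hypothesis P0 : forall x, P x 0 = 0.
Hypothesis dP : forall x s, is_derive s (1 : R) (P x) (\sum_i db i (X s x)).

(** [P x - P y] vanishes at time [0], and its derivative compares the divergence along two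
    trajectories that remain close up to time [T]. *)
Lemma primitive_unif_continuous x (T e : R) : 0 < e ->
  exists2 r : R, 0 < r &
    forall y t, `|x - y| < r -> `|t| <= T -> `|P x t - P y t| <= e.
Proof.
move=> e0; have [T0|T0] := ltP T 0.
  by exists 1 => // y t _ tT; have := le_lt_trans tT T0; rewrite normr_lt0.
have d0 : 0 < n%:R * T + 1 by rewrite ltr_wpDl// mulr_ge0.
have e'0 : 0 < e / (n%:R * T + 1) by rewrite divr_gt0.
have [r r0 Hr] := field_derive_unif_continuous regular (`|x| + M * T) e'0.
have E0 := expR_gt0 (n%:R * (T * M)).
(* Dividing by the Lipschitz constant of the flow keeps the trajectories within [r] of each
   other. *)
exists (r / expR (n%:R * (T * M))); first by rewrite divr_gt0.
move=> y t; rewrite ltr_pdivlMr// => xy tT.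
have dD s : is_derive s (1 : R) (fun s => P x s - P y s)
    (\sum_i db i (X s x) - \sum_i db i (X s y)).
  by have := dP x s => ?; have := dP y s => ?; exact: is_deriveB.
have [s] := MVT_symmetric 0 t dD; rewrite !P0 !subr0 => st ->.
have sT := le_trans st tT.
rewrite normrM -sumrB.
have H i : `|db i (X s x) - db i (X s y)| <= e / (n%:R * T + 1).
  apply: Hr.
    have := ler_normD x (X s x - x); rewrite subrKC => /le_trans; apply.
    have := integral_curve_lipschitz regular 0 s (dX x); rewrite X0 subr0.
    move=> /(lerD (lexx `|x|)) /le_trans; apply.
    by rewrite lerD2l ler_wpM2l.
  have := integral_curve_stable s (dX x) (dX y); rewrite !X0 => /le_lt_trans; apply.
  rewrite mulrC (le_lt_trans _ xy)// ler_wpM2l// ler_expR ler_wpM2l//.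
  by rewrite ler_wpM2r.
apply: (@le_trans _ _ (n%:R * (e / (n%:R * T + 1)) * T)).
  rewrite ler_pM// (le_trans (ler_norm_sum _ _ _))//.
  rewrite (le_trans (ler_sum _ (fun i _ => H i)))// sumr_const card_ord.
  by rewrite -[leLHS]mulr_natl.
rewrite mulrAC mulrA ler_pdivrMr// [e * _]mulrC ler_wpM2r ?ltW//.
by rewrite ltrDl.
Qed.

(* The Jacobian determinant of the flow [X t] at [x] is [expR (P x t)]. *)
Lemma liouville g t : continuous g -> bounded_support g ->
  (\int[lebesgue_rV n]_x (g (X t x) * expR (P x t))%:E =
   \int[lebesgue_rV n]_x (g x)%:E)%E.
Proof.
move=> cg sg; have [B gB] := sg; have [Mg Mg0 gM] := continuous_bounded cg sg.
pose h N : R := t / N.+1%:R.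
have hE N : N.+1%:R * `|h N| = `|t|.
  by rewrite /h normrM normfV [`|N.+1%:R|]ger0_norm// mulrCA mulfV ?mulr1.
pose f_ N x := g (shears b (h N) x (sweeps N.+1)) *
  shears_weight b db (h N) x (sweeps N.+1).
pose f x := g (X t x) * expR (P x t).
pose D := n%:R * (`|t| * M).
(* The total displacement bound [D] is independent of [N]; it supplies a common dominating function
   with bounded support. *)
have sizeE N : (size (sweeps N.+1 : seq 'I_n))%:R * (`|h N| * M) = D.
  by rewrite size_sweeps natrM /D -(hE N); ring.
have cf_ N : continuous (f_ N).
  apply: continuous_mul; last exact: (continuous_shears_weight regular).
  apply: (@continuous_compose _ _ _ (fun x => shears b (h N) x (sweeps N.+1)) g) => //.
  exact: (continuous_shears regular).
have f_f x : f_ N x @[N --> \oo] --> f x.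
  have dc : integral_curve b (X ^~ x) by [].
  have h1 := shears_cvg regular dc (t := t).
  have h2 := shears_weight_cvg regular dc (P0 x) (dP x) (t := t).
  rewrite /= X0 in h1 h2; apply: cvgM => //.
  by apply: continuous_cvg => //; exact: cg.
have f_K N x : `|f_ N x| <= Mg * expR D.
  rewrite /f_ normrM ler_pM// (le_trans (norm_shears_weight regular _ _ _))//.
  by rewrite sizeE.
have f_B N x : B + D < `|x| -> f_ N x = 0.
  move=> xB; rewrite /f_ gB ?mul0r//.
  have := norm_shearsB regular (h N) x (sweeps N.+1); rewrite sizeE distrC.
  have := ler_normD (shears b (h N) x (sweeps N.+1))
    (x - shears b (h N) x (sweeps N.+1)); rewrite subrKC.
  by move: xB; lra.
have H := dominated_convergence_bounded_support cf_ f_f f_K f_B.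
(* The change of variables is exact for every [N], so the convergent sequence of integrals is
   constant. *)
have E N : (\int[lebesgue_rV n]_x (f_ N x)%:E = \int[lebesgue_rV n]_x (g x)%:E)%E.
  exact: (integral_shears regular).
have cE : (fun N => \int[lebesgue_rV n]_x (f_ N x)%:E)%E =
    (fun=> \int[lebesgue_rV n]_x (g x)%:E)%E by apply/funext => N; exact: E.
rewrite cE in H.
by rewrite -[LHS](cvg_lim (@ereal_hausdorff R) H) lim_cst.
Qed.

End flow.

(** * Uniform bounds from periodicity *)

Section periodic_field.
Context {R : realType} {n : nat}.
Implicit Types (x y : 'rV[R]_n) (f : 'rV[R]_n -> R) (E : 'M[R]_n).

(** Every point is a lattice translate of a point of the fundamental cell, which is contained in a
    compact ball. *)
Lemma periodic_bounded f E : E \in unitmx -> continuous f ->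
  (forall x i, f (x + row i E) = f x) -> exists2 M, 0 < M & forall x, `|f x| <= M.
Proof.
move=> uE cf pf.
have pfn x i (k : nat) : f (x + k%:R *: row i E) = f x.
  elim: k => [|k IHk]; first by rewrite scale0r addr0.
  by rewrite -natr1 scalerDl scale1r addrA pf.
have pfz x i (z : int) : f (x + z%:~R *: row i E) = f x.
  case: z => k; first exact: pfn.
  rewrite NegzE mulrNz scaleNr.
  by have := pfn (x - k.+1%:R *: row i E) i k.+1; rewrite subrK => ->.
have pfs x (z : 'I_n -> int) (r : seq 'I_n) :
    f (x + \sum_(i <- r) (z i)%:~R *: row i E) = f x.
  elim: r => [|i r IHr]; first by rewrite big_nil addr0.
  by rewrite big_cons [X in x + X]addrC addrA pfz.
pose C := \sum_i \sum_j `|E i j|.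
have [M M0 fM] := compact_norm_bounded (@compact_norm_le R n C) cf.
exists M => // x.
(* [y] holds the coordinates of [x] in the basis of the edges; [w] keeps their fractional parts. *)
pose y := x *m invmx E; pose w := \row_i (y ord0 i - (Num.floor (y ord0 i))%:~R).
have -> : x = w *m E + \sum_i (Num.floor (y ord0 i))%:~R *: row i E.
  rewrite mulmx_sum_row -big_split /= -[LHS](mulmxKV uE) -/y mulmx_sum_row.
  by apply: eq_bigr => i _; rewrite [w _ _]mxE -scalerDl subrK.
rewrite pfs fM//= norm_rV_le//; first by rewrite !sumr_ge0// => i _; rewrite sumr_ge0.
move=> j; rewrite mxE (le_trans (ler_norm_sum _ _ _))//.
apply: ler_sum => i _; rewrite normrM (@le_trans _ _ `|E i j|)//.
  rewrite ler_piMl// [w _ _]mxE ger0_norm ?subr_ge0 ?ge_floor//.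
  by rewrite lerBlDr addrC -intrD1 ltW// floorD1_gt.
by rewrite (bigD1 j)//= lerDl sumr_ge0.
Qed.

Lemma is_derive_partials f x v : differentiable f x ->
  is_derive x v f (\sum_i v ord0 i * partial i f x).
Proof.
move=> df; apply: DeriveDef; first exact: diff_derivable.
rewrite deriveE// [in LHS](row_sum_delta v) linear_sum.
by apply: eq_bigr => i _; rewrite linearZ /partial deriveE.
Qed.

Lemma differentiable_lipschitz f (K : R) :
  (forall x, differentiable f x) -> (forall i x, `|partial i f x| <= K) ->
  forall x y, `|f x - f y| <= n%:R * K * `|x - y|.
Proof.
move=> df fK x y.
pose D (s : R) := \sum_i (x - y) ord0 i * partial i f (y + s *: (x - y)).
have dD s : is_derive s (1 : R) (fun s : R => f (y + s *: (x - y))) (D s).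
  by apply: is_derive_line; exact: is_derive_partials.
have [s _] := MVT_symmetric 0 1 dD.
rewrite scale1r scale0r addr0 subrKC subr0 mulr1 => ->.
rewrite (le_trans (ler_norm_sum _ _ _))//.
have H i : `|(x - y) ord0 i * partial i f (y + s *: (x - y))| <= K * `|x - y|.
  by rewrite normrM mulrC ler_pM// coord_le_norm.
rewrite (le_trans (ler_sum _ (fun i _ => H i)))//.
by rewrite sumr_const card_ord -mulrA -[leLHS]mulr_natl.
Qed.

Lemma periodic_partial f e j : (forall x, f (x + e) = f x) ->
  forall x, partial j f (x + e) = partial j f x.
Proof.
move=> pf x; rewrite /partial /derive.
have -> : (fun h : R =>
      h^-1 *: ((f \o shift (x + e)) (h *: delta_mx ord0 j) - f (x + e))) = (fun h : R => h^-1 *: ((f \o shift x) (h *: delta_mx ord0 j) - f x)).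
  by apply/funext => h /=; rewrite addrA !pf.
by [].
Qed.

Lemma periodic_bounded_C1_field (u : 'rV[R]_n -> R) E : E \in unitmx ->
  Cn 2 u -> edge_periodic E (grad u) ->
  exists M, bounded_C1_field (fun i => partial i u)
    (fun i => partial i (partial i u)) M.
Proof.
move=> uE [du Cu] per.
have per_b i x k : partial i u (x + row k E) = partial i u x.
  by have /rowP/(_ i) := per x k; rewrite !mxE.
have d_b i x : differentiable (partial i u) x by have [] := Cu i.
have c_db i j : continuous (partial j (partial i u)) by have [_] := Cu i; exact.
have c_b i : continuous (partial i u).
  by move=> x; exact: differentiable_continuous.
have H1 i : {M | 0 < M & forall x, `|partial i u x| <= M}.
  by apply/cid2; exact: (periodic_bounded uE).
have H2 (p : 'I_n * 'I_n) :
    {M | 0 < M & forall x, `|partial p.2 (partial p.1 u) x| <= M}.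
  have per_db x k : partial p.2 (partial p.1 u) (x + row k E) =
      partial p.2 (partial p.1 u) x.
    by apply: periodic_partial => y; exact: per_b.
  exact: (cid2 (periodic_bounded uE (@c_db p.1 p.2) per_db)).
pose K1 := \sum_i s2val (H1 i); pose K2 := \sum_p s2val (H2 p).
have K1P i x : `|partial i u x| <= K1.
  rewrite (le_trans (s2valP' (H1 i) x))// /K1 (bigD1 i)//= lerDl sumr_ge0//.
  by move=> j _; exact/ltW/(s2valP (H1 j)).
have K2P i j x : `|partial j (partial i u) x| <= K2.
  rewrite (le_trans (s2valP' (H2 (i, j)) x))// /K2 (bigD1 (i, j))//= lerDl sumr_ge0//.
  by move=> p _; exact/ltW/(s2valP (H2 p)).
have K10 : 0 <= K1 by apply: sumr_ge0 => i _; exact/ltW/(s2valP (H1 i)).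
have K20 : 0 <= K2 by apply: sumr_ge0 => i _; exact/ltW/(s2valP (H2 i)).
have nK20 : 0 <= n%:R * K2 by rewrite mulr_ge0.
(* The three terms bound the field, its Lipschitz constant and its derivatives. *)
exists (K1 + n%:R * K2 + K2); split => //.
- by rewrite !addr_ge0.
- by move=> i x; have := K1P i x; lra.
- move=> i x y; rewrite (le_trans (differentiable_lipschitz (d_b i) (K2P i) x y))//.
  by rewrite ler_wpM2r//; lra.
- by move=> i x; apply: derivableP; exact: diff_derivable.
- by move=> i x; have := K2P i i x; lra.
Qed.

End periodic_field.

(** * Scalar products and the chain rule along curves *)

Section invariant_density.
Context {R : realType} {n : nat}.
Implicit Types (x y : 'rV[R]_n) (t : R).

Lemma dotp_lipschitz (v x y : 'rV[R]_n) :
  `|dotp x v - dotp y v| <= (\sum_i `|v ord0 i|) * `|x - y|.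
Proof.
rewrite /dotp -sumrB mulr_suml (le_trans (ler_norm_sum _ _ _))//.
apply: ler_sum => i _; rewrite -mulrBl normrM mulrC ler_wpM2l//.
by have := coord_le_norm (x - y) i; rewrite !mxE.
Qed.

Lemma continuous_dotp (v : 'rV[R]_n) : continuous (dotp ^~ v).
Proof. exact: lipschitz_continuous_rV (dotp_lipschitz v). Qed.

Lemma is_derive_dotp (c : R -> 'rV[R]_n) t dc (v : 'rV[R]_n) :
  is_derive t (1 : R) c dc ->
  is_derive t (1 : R) (fun s => dotp (c s) v) (dotp dc v).
Proof.
move=> dct; rewrite /dotp.
have H i : is_derive t (1 : R) (fun s => c s ord0 i * v ord0 i) (dc ord0 i * v ord0 i).
  rewrite (_ : (fun s => _) = v ord0 i \*: (fun s => c s ord0 i)).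
    by rewrite mulrC; apply: is_deriveZ; exact: is_derive_coord.
  by apply/funext => s; rewrite mulrC.
rewrite (_ : (fun s => _) = \sum_i (fun s => c s ord0 i * v ord0 i)).
  exact: is_derive_sum.
by apply/funext => s; rewrite fct_sumE.
Qed.

Lemma is_derive_along (phi : 'rV[R]_n -> R) (c : R -> 'rV[R]_n) t dc :
  differentiable phi (c t) -> is_derive t (1 : R) c dc ->
  is_derive t (1 : R) (fun s => phi (c s)) (dotp dc (grad phi (c t))).
Proof.
move=> dphi [dc1 dcE]; have dct : differentiable c t by exact/derivable1_diffP.
apply: DeriveDef; first exact/derivable1_diffP/differentiable_comp.
rewrite deriveE; last exact: differentiable_comp.
rewrite (diff_comp dct dphi) /= -[X in 'd phi _ X]deriveE// dcE -deriveE//.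
have [_ ->] := is_derive_partials dc dphi.
by apply: eq_bigr => i _; rewrite mxE.
Qed.

End invariant_density.

(** * Crossing time and invariant densities *)

Section transversal_flow.
Context {R : realType} {n : nat}.
Implicit Types (x y : 'rV[R]_n) (t : R).
Variables (b db : 'I_n -> 'rV[R]_n -> R) (M : R).
Hypothesis regular : bounded_C1_field b db M.
Variable X : R -> 'rV[R]_n -> 'rV[R]_n.
Hypothesis X0 : forall x, X 0 x = x.
Hypothesis dX : forall x, integral_curve b (X ^~ x).
Let M0 := field_bound_ge0 regular.

Let norm_flow t x : `|X t x - x| <= M * `|t|.
Proof. by have := integral_curve_lipschitz regular 0 t (dX x); rewrite X0 subr0. Qed.

Let cX t : continuous (X t).
Proof. exact: (continuous_flow regular X0 dX). Qed.

Section crossing_time.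
Variables (nu : 'rV[R]_n) (h : R) (tau : 'rV[R]_n -> R).
Hypothesis tauP : forall x t, dotp (X t x) nu = h <-> t = tau x.
Hypothesis transversal :
  forall x, dotp (\row_i b i (X (tau x) x)) nu != 0.

Lemma crossing_time_flow t x : tau (X t x) = tau x - t.
Proof.
apply/esym/tauP; rewrite -(flow_semigroup regular X0 dX) subrK.
exact/tauP.
Qed.

(** The factor [m], the normal velocity at the crossing, makes the crossing always upward whatever
    the sign of [m]. *)
Lemma crossing_sign_change x (e : R) : 0 < e ->
  let m := dotp (\row_i b i (X (tau x) x)) nu in
  exists2 d : R, 0 < d < e &
    m * (dotp (X (tau x - d) x) nu - h) < 0 /\
    0 < m * (dotp (X (tau x + d) x) nu - h).
Proof.
move=> e0 m; have m0 : 0 < `|m| by rewrite normr_gt0; exact: transversal.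
have [dF FE] := is_derive_dotp nu (dX x (tau x)).
have : (fun r : R =>
      r^-1 *: (dotp (X (r *: (1 : R) + tau x) x) nu - dotp (X (tau x) x) nu)) @ 0^' --> m by rewrite /m -FE; exact: dF.
rewrite (tauP x (tau x)).2// => /cvgrPdist_lt /(_ _ m0) /nbhs_ballP[r /= r0 Hr].
pose d := Num.min (r / 2) (e / 2).
have d0 : 0 < d by rewrite lt_min !divr_gt0.
have dr : d < r by rewrite gt_min; apply/orP; left; lra.
have de : d < e by rewrite gt_min; apply/orP; right; lra.
have sgn s : `|s| < r -> s != 0 -> 0 < m * (s^-1 * (dotp (X (s + tau x) x) nu - h)).
  move=> sr s0; have := Hr s; rewrite -ball_normE /= sub0r normrN.
  move=> /(_ sr s0); rewrite [s *: 1]mulr1.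
  rewrite [_ *: _]/(s^-1 * _); set q := s^-1 * _ => H.
  have := sqr_ge0 q; have := sqr_ge0 (m - q).
  (* A difference quotient [q] closer to [m] than [0] is has the sign of [m]: expanding the square
     gives [q ^+ 2 < 2 * m * q]. *)
  have : (m - q) ^+ 2 < m ^+ 2.
    by rewrite -[ltLHS]real_normK ?num_real// -[ltRHS]real_normK ?num_real// ltr_pXn2r.
  nra.
exists d; first by rewrite d0.
have := sgn d; have := sgn (- d); rewrite normrN gtr0_norm// oppr_eq0 gt_eqF//.
move=> /(_ dr isT) H1 /(_ dr isT) H2; split.
  rewrite -oppr_gt0 -(pmulr_rgt0 _ (_ : 0 < d^-1)) ?invr_gt0//.
  by rewrite [tau x - d]addrC mulrN -mulNr -invrN mulrCA.
rewrite -(pmulr_rgt0 _ (_ : 0 < d^-1)) ?invr_gt0//.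
by rewrite [tau x + d]addrC mulrCA.
Qed.

(** The strict signs at [tau x - d] and [tau x + d] persist for nearby [y]. The intermediate value
    theorem gives a crossing in between, which by uniqueness occurs at [tau y]. *)
Lemma continuous_crossing_time : continuous tau.
Proof.
move=> x.
suff : forall e : R, 0 < e -> \forall y \near x, `|tau x - tau y| < e.
  by move=> /cvgrPdist_lt.
move=> e e0; have [d /andP[d0 de] [H1 H2]] := crossing_sign_change x e0.
set m := dotp _ nu in H1 H2.
pose F s y := m * (dotp (X s y) nu - h).
have cF s : continuous (F s).
  apply: continuous_mul; first exact: continuous_cst.
  apply: continuous_add; last exact: continuous_cst.
  by apply: (@continuous_compose _ _ _ (X s) (dotp ^~ nu)) => //; exact: continuous_dotp.
have N1 : \forall y \near x, F (tau x - d) y < 0.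
  exact: (cvgr_lt _ (cF (tau x - d) x) _ H1).
have N2 : \forall y \near x, 0 < F (tau x + d) y.
  exact: (cvgr_gt _ (cF (tau x + d) x) _ H2).
near=> y.
have y1 : F (tau x - d) y < 0 by near: y.
have y2 : 0 < F (tau x + d) y by near: y.
have dFy s : is_derive s (1 : R) (fun s => F s y) (m * dotp (\row_i b i (X s y)) nu).
  have ? := is_derive_dotp nu (dX y s).
  apply: (@is_deriveZ _ _ _ (fun s => dotp (X s y) nu - h)).
  by apply: is_derive_eq; rewrite subr0.
have dd : tau x - d <= tau x + d by lra.
have F0 : Num.min (F (tau x - d) y) (F (tau x + d) y) <= 0 <=
    Num.max (F (tau x - d) y) (F (tau x + d) y).
  by rewrite ge_min le_max (ltW y1) (ltW y2) orbT.
have [s] := @IVT R (fun s => F s y) _ _ 0 dd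
  (continuous_subspaceT (is_derive_continuous dFy)) F0.
rewrite in_itv /= => sd /eqP; rewrite mulf_eq0 (negbTE (transversal x)) /=.
rewrite subr_eq0 => /eqP/tauP sE; rewrite -sE.
by rewrite (le_lt_trans _ de)// ler_distlC; move: sd; lra.
Unshelve. all: by end_near. Qed.

End crossing_time.

Section density.
Variable P : 'rV[R]_n -> R -> R.
Hypothesis P0 : forall x, P x 0 = 0.
Hypothesis dP : forall x s, is_derive s (1 : R) (P x) (\sum_i db i (X s x)).

(** The cocycle identity for the logarithm of the Jacobian: by the semigroup law both sides have the
    same derivative in [s], and both vanish at [0]. *)
Lemma primitive_flow s t x : P (X t x) s = P x (s + t) - P x t.
Proof.
have d r : is_derive r (1 : R) (fun r => P (X t x) r - P x (r + t)) 0.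
  have ? := dP (X t x) r.
  have ? : is_derive r (1 : R) (fun r => P x (r + t)) (\sum_i db i (X (r + t) x)).
    by apply: is_derive_translate; exact: dP.
  by apply: is_derive_eq; rewrite (flow_semigroup regular X0 dX) subrr.
have [r _] := MVT_symmetric 0 s d; rewrite /= P0 mul0r !add0r; lra.
Qed.

(** First the time varies with [x] fixed, then the base point varies, uniformly over the times
    bounded by [|tau x| + 1]. *)
Lemma continuous_primitive_time (tau : 'rV[R]_n -> R) :
  continuous tau -> continuous (fun x => P x (tau x)).
Proof.
move=> ctau x.
suff : forall e : R, 0 < e -> \forall y \near x, `|P x (tau x) - P y (tau y)| < e.
  by move=> /cvgrPdist_lt.
move=> e e0; have e20 : 0 < e / 2 by rewrite divr_gt0.
have [r r0 Hr] := primitive_unif_continuous regular X0 dX P0 dP x (`|tau x| + 1) e20.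
have cPx : continuous (fun y => P x (tau y)).
  by apply: continuous_compose => //; exact: (is_derive_continuous (dP x)).
near=> y.
have h1 : `|P x (tau x) - P x (tau y)| < e / 2.
  near: y; have /cvgrPdist_lt := cPx x; exact.
have h2 : `|tau x - tau y| < 1 by near: y; have /cvgrPdist_lt := ctau x; exact.
have h3 : `|P x (tau y) - P y (tau y)| <= e / 2.
  apply: Hr.
    near: y; apply/nbhs_ballP; exists r => // y /=.
    by rewrite -ball_normE.
  have := ler_normD (tau x) (tau y - tau x); rewrite subrKC distrC; lra.
have := ler_distD (P x (tau y)) (P x (tau x)) (P y (tau y)); lra.
Unshelve. all: by end_near. Qed.

(** The difference quotients [q N] of [s x * phi (X t x)] at [t = 0] have zero integral by
    invariance and converge boundedly to the integrand, with a common bounded support. *)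
Lemma invariant_density_divergence_free (s phi : 'rV[R]_n -> R) :
  continuous s -> (forall t x, s (X t x) * expR (P x t) = s x) ->
  (forall x, differentiable phi x) -> (forall i, continuous (partial i phi)) ->
  bounded_support phi ->
  (\int[lebesgue_rV n]_x (s x * dotp (\row_i b i x) (grad phi x))%:E = 0)%E.
Proof.
move=> cs invs dphi cdphi sphi; have [B phiB] := sphi.
have cphi : continuous phi by move=> x; exact: differentiable_continuous.
pose D x := dotp (\row_i b i x) (grad phi x).
have cD : continuous D.
  apply: continuous_sum => i; under eq_fun do rewrite !mxE.
  apply: continuous_mul => //.
  exact: lipschitz_continuous_rV (@field_lipschitz _ _ _ _ _ regular i).
have dphiX x t : is_derive t (1 : R) (fun r => phi (X r x)) (D (X t x)).
  by apply: is_derive_along => //; exact: dX.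
pose q N x := N.+1%:R * (s x * phi (X N.+1%:R^-1 x) - s x * phi x).
have qE N x : exists2 r : R, `|r| <= N.+1%:R^-1 & q N x = s x * D (X r x).
  have [r] := MVT_symmetric 0 N.+1%:R^-1 (dphiX x).
  rewrite !subr0 X0 normfV [`|N.+1%:R|]ger0_norm// => rN E; exists r => //.
  by rewrite /q -mulrBr E; field; rewrite addrC natr1.
have sphi' t : bounded_support (fun x => s x * phi (X t x)).
  have [C HC] := bounded_support_displacement sphi (norm_flow t).
  by exists C => x xC; rewrite HC// mulr0.
have cphi' t : continuous (fun x => s x * phi (X t x)).
  by apply: continuous_mul => //; apply: (@continuous_compose _ _ _ (X t) phi).
have int t := integrable_bounded_support (cphi' t) (sphi' t).
have cphi0 : continuous (fun x => s x * phi x) by exact: continuous_mul.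
have sphi0 : bounded_support (fun x => s x * phi x).
  by exists B => x xB; rewrite phiB// mulr0.
have int0 := integrable_bounded_support cphi0 sphi0.
have liouville_phi t : (\int[lebesgue_rV n]_x (s x * phi (X t x))%:E =
    \int[lebesgue_rV n]_x (s x * phi x)%:E)%E.
  (* Liouville's formula is applied to [s * phi]; invariance then absorbs the Jacobian into
     [s x]. *)
  rewrite -(liouville regular X0 dX P0 dP t cphi0 sphi0).
  by apply: eq_integral => x _; rewrite mulrAC invs.
have q0 N : (\int[lebesgue_rV n]_x (q N x)%:E = 0)%E.
  under eq_integral do rewrite /q EFinM EFinB.
  rewrite integralZl//; last first.
    by apply: (integrableB _ (int N.+1%:R^-1) int0).
  rewrite (integralB_EFin _ (int N.+1%:R^-1) int0)// liouville_phi subee ?mule0//.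
  exact: (integrable_fin_num _ int0).
have cq N : continuous (q N).
  apply: continuous_mul; first exact: continuous_cst.
  move=> x; apply: (@continuousB _ _ _ (fun x => s x * phi (X N.+1%:R^-1 x))
    (fun x => s x * phi x)); first exact: cphi'.
  exact: cphi0.
have q_cvg x : q ^~ x @ \oo --> s x * D x.
  have cDX : continuous (fun r => s x * D (X r x)).
    apply: continuous_mul; first exact: continuous_cst.
    apply: (@continuous_compose _ _ _ (X ^~ x) D) => //.
    exact: (is_derive_continuous (dX x)).
  apply/cvgrPdist_lt => e e0.
  have /cvgrPdist_lt /(_ _ e0) /nbhs_ballP[r /= r0 Hr] := cDX 0.
  near=> N; have [t tN ->] := qE N x.
  have := Hr t; rewrite X0; apply.
  rewrite -ball_normE /= sub0r normrN (le_lt_trans tN)//.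
  by near: N; exact: near_infty_natSinv_lt (PosNum r0).
have N1 N : N.+1%:R^-1 <= 1 :> R by rewrite invf_le1// ler1n.
have qB N x : B + M < `|x| -> q N x = 0.
  move=> xB; rewrite /q !phiB ?mulr0 ?subrr ?mulr0//; first by move: M0 xB; lra.
  have := norm_flow N.+1%:R^-1 x; rewrite distrC => hx.
  have : M * `|N.+1%:R^-1| <= M by rewrite ler_piMr// ger0_norm.
  have := ler_normD (X N.+1%:R^-1 x) (x - X N.+1%:R^-1 x); rewrite subrKC.
  by move: hx xB; lra.
(* The support of [q N] lies in the ball of radius [B + M], and the intermediate point [X r x] given
   by [qE] is at most [M] further out. *)
have [Ks _ HKs] := compact_norm_bounded (@compact_norm_le R n (B + M + M)) cs.
have [KD _ HKD] := compact_norm_bounded (@compact_norm_le R n (B + M + M)) cD.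
have HK N x : `|q N x| <= `|Ks| * `|KD|.
  have [xB|/qB->] := leP `|x| (B + M); last by rewrite normr0 mulr_ge0.
  have [r rN ->] := qE N x.
  have rM : M * `|r| <= M by rewrite ler_piMr// (le_trans rN).
  rewrite normrM ler_pM// (le_trans _ (ler_norm _))//.
    by apply: HKs => /=; move: xB M0; lra.
  apply: HKD => /=; have := ler_normD x (X r x - x); rewrite subrKC.
  by have := norm_flow r x; move: xB rM; lra.
have := dominated_convergence_bounded_support cq q_cvg HK qB.
have -> : (fun N => \int[lebesgue_rV n]_x (q N x)%:E)%E = (fun=> 0%E).
  by apply/funext => N; exact: q0.
by move=> /(cvg_lim (@ereal_hausdorff R)) <-; rewrite lim_cst.
Unshelve. all: by end_near. Qed.

End density.
End transversal_flow.

(** * Admissibility of the conductivity and conclusion *)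

Lemma continuous_Linfty_loc {R : realType} n (s : 'rV[R]_n -> R) :
  continuous s -> Linfty_loc s.
Proof.
move=> cs; split; first exact: continuous_measurable_rV.
move=> K cK; have [C C0 sC] := compact_norm_bounded cK cs.
rewrite unlock; case: ifPn => // _; apply: (@le_lt_trans _ _ C%:E); last exact: ltry.
apply/ess_supP; apply: aeW => x /=; rewrite lee_fin patchE.
by case: ifPn => [/set_mem/sC//|_]; rewrite normr0 ltW.
Qed.

Lemma test_function_bounded_support {R : realType} n (phi : 'rV[R]_n -> R) :
  test_function phi -> bounded_support phi.
Proof.
move=> [_ /compact_bounded[B [_ HB]]]; exists (B + 1) => x xB.
apply/eqP; apply: contraLR (xB) => phix; rewrite -leNgt.
by apply: HB; [rewrite ltrDl|exact: subset_closure].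
Qed.

Theorem proposition2p10 (R : realType) (d : nat) (hd : (2 <= d)%N)
    (a : 'rV[R]_d) (E : 'M[R]_d) (hE : E \in unitmx)
    (u : 'rV[R]_d -> R) (u_C2 : Cn 2 u)
    (grad_periodic : edge_periodic E (grad u))
    (grad_average : average (parallelepiped a E) (grad u) <> 0)
    (grad_neq0 : forall x : 'rV[R]_d, grad u x <> 0)
    (X : R -> 'rV[R]_d -> 'rV[R]_d) (X_flow : is_flow (grad u) X)
    (X_hyperplane : exists (nu : 'rV[R]_d) (h : R),
       nu <> 0 /\
       exists (z_H : 'rV[R]_d -> 'rV[R]_d) (tau_H : 'rV[R]_d -> R),
         forall x : 'rV[R]_d,
           [/\ z_H x = X (tau_H x) x,
               range (fun t : R => X t x) `&` hyperplane nu h = [set z_H x],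
               [set t : R | hyperplane nu h (X t x)] = [set tau_H x] &
               dotp (grad u (z_H x)) nu <> 0]) :
  isotropically_realizable u.
Proof.
have [M regular] := periodic_bounded_C1_field hE u_C2 grad_periodic.
have X0 x : X 0 x = x by case: (X_flow x).
have dX x : integral_curve (fun i => partial i u) (X ^~ x).
  by move=> t; case: (X_flow x) => _ /(_ t).
have [nu [h [_ [z_H [tau Htau]]]]] := X_hyperplane.
(* Equality with a singleton carries both existence and uniqueness of the crossing time. *)
have tauP x t : dotp (X t x) nu = h <-> t = tau x.
  by have [_ _ /seteqP[sub sup] _] := Htau x; split=> [/sub|/sup].
have transversal x : dotp (\row_i partial i u (X (tau x) x)) nu != 0.
  by have [<- _ _ /eqP] := Htau x.
have c_div x : continuous (fun s => \sum_i partial i (partial i u) (X s x)).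
  apply: continuous_sum => i.
  apply: (@continuous_compose _ _ _ (X ^~ x) (partial i (partial i u))).
    exact: (is_derive_continuous (dX x)).
  exact: (field_derive_continuous regular).
pose P x := s2val (cid2 (antiderivative (c_div x))).
have P0 x : P x 0 = 0 by rewrite /P; case: cid2.
have dP x s : is_derive s (1 : R) (P x) (\sum_i partial i (partial i u) (X s x)).
  by rewrite /P; case: cid2.
pose sigma x := expR (P x (tau x)).
have csigma : continuous sigma.
  apply: (@continuous_compose _ _ _ (fun x => P x (tau x)) expR).
    apply: (continuous_primitive_time regular X0 dX P0 dP).
    exact: (continuous_crossing_time regular X0 dX tauP transversal).
  exact: continuous_expR.
exists sigma; split; first exact: continuous_Linfty_loc.
  by move=> x; exact: expR_gt0.
move=> phi phi_test; have [dphi cdphi] := phi_test.1 1.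
rewrite /distr_div /Rintegral.
have -> : (\int[lebesgue_rV d]_x (dotp (sigma x *: grad u x) (grad phi x))%:E = 0)%E.
  rewrite -(invariant_density_divergence_free regular X0 dX P0 dP csigma _ dphi
    cdphi (test_function_bounded_support phi_test)).
    apply: eq_integral => x _; congr (_%:E); rewrite /dotp mulr_sumr.
    by apply: eq_bigr => i _; rewrite !mxE mulrA.
  (* Invariance of [sigma]: the time left to cross from [X t x] is [tau x - t], and the cocycle
     identity adds [P x t] back to give [P x (tau x)]. *)
  move=> t x; rewrite /sigma (crossing_time_flow regular X0 dX tauP).
  by rewrite (primitive_flow regular X0 dX P0 dP) subrK -expRD subrK.
by rewrite oppr0.
Qed.
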